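(* The monoid $\mathrm{Emb}(\mathbb{Q},circ)$ has automatic homeomorphicity: for every countable set $\Omega$ and every monoid isomorphism $\theta$ from $\mathrm{Emb}(\mathbb{Q},circ)$ onto a closed submonoid of $Tr(\Omega)$, $\theta$ is a homeomorphism.
   Context: The strict circular order on $\mathbb{Q}$ is the ternary relation $circ(x,y,z)$ iff $x<y<z$ or $y<z<x$ or $z<x<y$. $\mathrm{Emb}(\mathbb{Q},circ)$ is the monoid of injective maps $f:\mathbb{Q}\to\mathbb{Q}$ such that $circ(x,y,z)$ implies $circ(f(x),f(y),f(z))$. For a countable set $X$, $Tr(X)$ is the monoid of all maps $X\to X$. Transformation monoids carry the topology of pointwise convergence, whose basic open sets are $\{f : f(b_k)=c_k \text{ for } k=1,\dots,n\}$ for finite tuples of points. *)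

(* Defs.v *)
From HB Require Import structures.
From mathcomp Require Import all_boot all_order all_algebra.
From mathcomp Require Import all_classical topology.

Set Implicit Arguments.
Unset Strict Implicit.
Unset Printing Implicit Defensive.

Local Open Scope classical_set_scope.
Local Open Scope group_scope.

Definition Tr (X : countType) : Type := X -> X.

Section Tr.
Variable X : countType.

HB.instance Definition _ :=
  Topological.copy (Tr X) {ptws X -> discrete_topology X}.

(* Maps act on the left: [f * g] is "first g, then f", in every [Tr X]. *)
Definition Tr_one : Tr X := idfun.
Definition Tr_mul (f g : Tr X) : Tr X := f \o g.

Fact Tr_mulA : associative Tr_mul. Proof. by []. Qed.
Fact Tr_mul1g : left_id Tr_one Tr_mul. Proof. by []. Qed.
Fact Tr_mulg1 : right_id Tr_one Tr_mul. Proof. by []. Qed.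

HB.instance Definition _ := isMonoid.Build (Tr X) Tr_mulA Tr_mul1g Tr_mulg1.

(* Prescribing the values at finitely many points gives a neighbourhood base. *)
Lemma nbhs_Tr (f : Tr X) (A : set (Tr X)) :
  nbhs f A <-> exists s : seq X, [set g : Tr X | {in s, g =1 f}] `<=` A.
Proof.
split=> [|[s]]; last first.
  move/filterS; apply; elim: s => [|x s IHs]; first by apply: filterS filterT.
  have fx : nbhs f [set g : Tr X | g x = f x].
    exact: (@proj_continuous X (fun=> discrete_topology X) x f _
      (@discrete_set1 (discrete_topology X) (f x))).
  apply: filterS (filterI fx IHs) => g [gx gs] y.
  by rewrite inE => /predU1P[->|/gs].
pose F : set_system (Tr X) :=
  [set B | exists s : seq X, [set g : Tr X | {in s, g =1 f}] `<=` B].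
have FF : Filter F.
  split; first by exists [::].
    move=> P Q [s sP] [t tQ]; exists (s ++ t) => g gst; split.
      by apply: sP => x xs; apply: gst; rewrite mem_cat xs.
    by apply: tQ => x xt; apply: gst; rewrite mem_cat xt orbT.
  by move=> P Q PQ [s sP]; exists s; apply: subset_trans sP PQ.
suff : F --> f by apply.
apply/cvg_sup => x B [_ [[C _ <-] Cfx] CB].
by exists [:: x] => g gx; apply: CB; rewrite /= gx ?mem_head.
Qed.

End Tr.

Record submonoid (G : monoidType) := Submonoid {
  submonoid_set : set G;
  submonoid_closed : monoid_closed (mem submonoid_set)
}.

Definition submonoid_type (G : monoidType) (M : submonoid G) : Type :=
  set_type (submonoid_set M).
Coercion submonoid_type : submonoid >-> Sortclass.

HB.instance Definition _ (G : monoidType) (M : submonoid G) :=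
  SubChoice.copy (submonoid_type M) {x : G | x \in submonoid_set M}.
HB.instance Definition _ (G : monoidType) (M : submonoid G) :=
  SubChoice_isSubMonoid.Build G _ (submonoid_type M) (submonoid_closed M).
(* The topology of [set_type] is the one induced by the inclusion in [Tr X]. *)
HB.instance Definition _ (X : countType) (M : submonoid (Tr X)) :=
  Topological.copy (submonoid_type M) (set_type (submonoid_set M)).

Definition monoid_isomorphism (G H : monoidType) (theta : G -> H) : Prop :=
  monoid_morphism theta /\ bijective theta.

Definition homeomorphism (S T : topologicalType) (theta : S -> T) : Prop :=
  continuous theta /\
  exists eta : T -> S, [/\ cancel theta eta, cancel eta theta & continuous eta].

Definition automatic_homeomorphicity (X : countType) (M : submonoid (Tr X)) :=
  forall (Omega : countType) (N : submonoid (Tr Omega)) (theta : M -> N),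
    closed (submonoid_set N) -> monoid_isomorphism theta -> homeomorphism theta.

Definition circ (x y z : rat) : bool :=
  [|| (x < y < z)%R, (y < z < x)%R | (z < x < y)%R].

Definition Emb_circ_set : set (Tr rat) :=
  [set f | injective f /\ forall x y z, circ x y z -> circ (f x) (f y) (f z)].

Fact Emb_circ_closed : monoid_closed (mem Emb_circ_set).
Proof.
split=> [|f g]; rewrite !inE /=; first by split=> // x y.
move=> [fI fC] [gI gC]; split; first exact: inj_comp.
by move=> x y z /gC /fC.
Qed.

Definition Emb_circ : submonoid (Tr rat) := Submonoid Emb_circ_closed.

(* Main.v *)
From HB Require Import structures.
From mathcomp Require Import all_boot all_order all_algebra.
From mathcomp Require Import all_classical topology.
From mathcomp Require Import zify lra.
Require Import Defs.

(**
Write G for the automorphism group of the circular order; it is the group of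
units of Emb(Q, circ) and it is dense there.

1. The stabiliser of a point in G is Aut(Q, <), which has the small index
property: a subgroup H of countable index contains the pointwise stabiliser of a
finite set F. By Baire category H is dense in the stabiliser of some F. If
intervals K_n are disjoint, then H contains all automorphisms supported on a
tail of a sequence of smaller intervals C_n in K_n: diagonalising over the cosets
shows that H induces every automorphism of some member of a disjoint family,
hence contains commutators, and every automorphism supported on a displaceable
set is a commutator. Density together with these tails gives everything supported
off F. Hence the isomorphism theta is continuous on G.

2. By density, theta on G extends to a continuous homomorphism on the whole
monoid, whose values lie in the closed image; composed with the inverse of theta
it is an endomorphism psi fixing G pointwise. If g u f = u f with g in G, then
g psi(u f) = psi(u f), so for an embedding u with sparse image psi(u f) maps into
the image of u f. This forces psi to be the identity, so theta is continuous.

3. A point of Omega moved by G has a least finite support F in Q, which is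
permuted by the stabiliser of that point. Two translates of F meeting only in q
yield two points of Omega whose stabilisers together fix q, so the inverse of
theta is continuous.
*)

Set Implicit Arguments.
Unset Strict Implicit.
Unset Printing Implicit Defensive.

Import Order.TTheory GRing.Theory Num.Theory.
Local Open Scope order_scope.
Local Open Scope group_scope.

(** * Back and forth *)

(** The Rasiowa-Sikorski argument: countably many dense requirements are met one after another. It
    drives both back and forth and the Baire category argument. *)
Lemma generic_chain (T : Type) (P : set T) (le : T -> T -> Prop)
    (C : nat -> set T) :
  (forall p, le p p) -> (forall p q r, le p q -> le q r -> le p r) ->
  (forall n p, P p -> exists q, [/\ P q, le p q & C n q]) ->
  forall p, P p -> exists s : nat -> T,
    [/\ s 0%N = p, forall n, P (s n), forall n, C n (s n.+1)
      & forall m n, (m <= n)%N -> le (s m) (s n)].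
Proof.
move=> lexx le_trans denseC p Pp.
have /choice[f fP] : forall np : nat * T, exists q,
    P np.2 -> [/\ P q, le np.2 q & C np.1 q].
  move=> [n q]; have [/(denseC n)[r rP]|] := pselect (P q); first by exists r.
  by exists q.
pose s := fix s n := if n is m.+1 then f (m, s m) else p.
have Ps n : P (s n) by elim: n => //= n /(fP (n, _))[].
exists s; split=> // [n|m n]; first by case: (fP (n, s n) (Ps n)).
elim: n => [|n IHn]; first by rewrite leqn0 => /eqP->.
rewrite leq_eqVlt => /predU1P[->//|/IHn mn].
by apply: le_trans mn _; case: (fP (n, s n) (Ps n)).
Qed.

(* Countable linear orders of type eta, presented on a subset of a type. The
   saturation clause gathers nonemptiness, density and absence of endpoints. *)
Record eta_order (T : eqType) (D : set T) (lt : rel T) : Prop := EtaOrder {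
  eta_irr : forall x, D x -> lt x x = false;
  eta_trans : forall x y z, D x -> D y -> D z -> lt x y -> lt y z -> lt x z;
  eta_total : forall x y, D x -> D y -> [\/ x = y, lt x y | lt y x];
  eta_sat : forall l r : seq T,
    {in l, forall x, D x} -> {in r, forall y, D y} ->
    {in l & r, forall x y, lt x y} ->
    exists z, [/\ D z, {in l, forall x, lt x z} & {in r, forall y, lt z y}] }.

Lemma eta_asym (T : eqType) (D : set T) (lt : rel T) : eta_order D lt ->
  forall x y, D x -> D y -> lt x y -> lt y x = false.
Proof.
move=> oD x y Dx Dy xy; apply/negbTE/negP=> yx.
by move: (eta_trans oD Dx Dy Dx xy yx); rewrite (eta_irr oD).
Qed.

Lemma has_greatest (T : eqType) (D : set T) (lt : rel T) (s : seq T) :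
  (forall x y z, D x -> D y -> D z -> lt x y -> lt y z -> lt x z) ->
  (forall x y, D x -> D y -> [\/ x = y, lt x y | lt y x]) ->
  {in s, forall x, D x} -> s != [::] ->
  exists2 m, m \in s & {in s, forall x, x = m \/ lt x m}.
Proof.
move=> ltT tot; elim: s => [//|x [|y s] IHs] Ds _.
  by exists x; rewrite ?mem_head // => z; rewrite inE => /eqP; left.
have Ds' : {in y :: s, forall x, D x} by move=> z zs; apply: Ds; rewrite inE zs orbT.
have Dx : D x by apply: Ds; rewrite mem_head.
have [//|m ms mmax] := IHs Ds'.
have Dm := Ds' _ ms; have [xm|xm|mx] := tot _ _ Dx Dm.
- exists m; first by rewrite inE ms orbT.
  by move=> z; rewrite inE => /predU1P[->|/mmax]; [left|].
- exists m; first by rewrite inE ms orbT.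
  by move=> z; rewrite inE => /predU1P[->|/mmax]; [right|].
- exists x; first by rewrite mem_head.
  move=> z; rewrite inE => /predU1P[->|zs]; [by left|right].
  by case: (mmax z zs) => [->//|zm]; apply: (ltT _ m) => //; apply: Ds'.
Qed.

(** A nonempty finite set has a greatest and a least element, so saturation reduces to separating at
    most two points. *)
Lemma eta_order_dense (T : eqType) (D : set T) (lt : rel T) :
  (forall x, D x -> lt x x = false) ->
  (forall x y z, D x -> D y -> D z -> lt x y -> lt y z -> lt x z) ->
  (forall x y, D x -> D y -> [\/ x = y, lt x y | lt y x]) ->
  (exists x, D x) ->
  (forall x, D x -> exists2 y, D y & lt y x) ->
  (forall x, D x -> exists2 y, D y & lt x y) ->
  (forall x y, D x -> D y -> lt x y -> exists z, [/\ D z, lt x z & lt z y]) ->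
  eta_order D lt.
Proof.
move=> irr ltT tot [d Dd] lo hi dense; split=> // l r Dl Dr lr.
pose gt : rel T := fun x y => lt y x.
have lmax : l != [::] -> exists2 m, m \in l & {in l, forall x, x = m \/ lt x m}.
  by move=> l0; apply: (@has_greatest _ D lt).
have rmin : r != [::] -> exists2 m, m \in r & {in r, forall x, x = m \/ lt m x}.
  apply: (@has_greatest _ D gt) => // [x y z Dx Dy Dz yx zy|x y Dx Dy].
    exact: (ltT _ y).
  by case: (tot x y Dx Dy); [constructor 1|constructor 3|constructor 2].
have [l0|/lmax[m ml mmax]] := eqVneq l [::].
  have [r0|/rmin[n nr nmin]] := eqVneq r [::].
    by rewrite l0 r0; exists d; split.
  have [z Dz zn] := lo n (Dr _ nr); exists z; split=> //; first by rewrite l0.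
  by move=> y yr; case: (nmin y yr) => [->//|ny]; apply: (ltT _ n) => //; apply: Dr.
have Dm := Dl _ ml.
have below z : D z -> lt m z -> {in l, forall x, lt x z}.
  by move=> Dz mz x xl; case: (mmax x xl) => [->//|xm]; apply: (ltT _ m) => //; apply: Dl.
have [r0|/rmin[n nr nmin]] := eqVneq r [::].
  by have [z Dz mz] := hi m Dm; exists z; rewrite r0; split=> //; apply: below.
have [z [Dz mz zn]] := dense m n Dm (Dr _ nr) (lr _ _ ml nr).
exists z; split=> //; first exact: below.
by move=> y yr; case: (nmin y yr) => [->//|ny]; apply: (ltT _ n) => //; apply: Dr.
Qed.

(** Finite partial isomorphisms as lists of pairs. Between eta orders, irreflexivity and totality
    make such a list the graph of an injective function. *)
Definition piso (T U : eqType) (D : set T) (E : set U) (lt : rel T)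
    (lt' : rel U) (p : seq (T * U)) :=
  {in p, forall a, [/\ D a.1, E a.2 & {in p, forall b, lt a.1 b.1 = lt' a.2 b.2}]}.

Definition swap (T U : Type) (a : T * U) := (a.2, a.1).

Lemma mem_swap (T U : eqType) (p : seq (T * U)) a :
  (a \in map (@swap T U) p) = (swap a \in p).
Proof.
apply/mapP/idP => [[b bp ->]|ap]; first by case: b bp.
by exists (swap a) => //; case: a ap.
Qed.

Lemma piso_swap (T U : eqType) (D : set T) (E : set U) lt lt' p :
  piso D E lt lt' p -> piso E D lt' lt (map (@swap T U) p).
Proof.
move=> pp a; rewrite mem_swap => /pp[Da Ea pa]; split=> // b.
by rewrite mem_swap => /pa.
Qed.

Lemma piso_forth (T U : eqType) (D : set T) (E : set U) lt lt' p x :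
  eta_order D lt -> eta_order E lt' -> piso D E lt lt' p -> D x ->
  exists y, piso D E lt lt' ((x, y) :: p).
Proof.
move=> oD oE pp Dx.
have [/mapP[[x' y] xyp /= ->]|xNp] := boolP (x \in map fst p).
  exists y; have [Dx' Ey pxy] := pp _ xyp; move=> a; rewrite inE.
  have sub b : b \in (x', y) :: p -> b \in p by rewrite inE => /predU1P[->|].
  move=> /predU1P[->|ap]; first by split=> // b /sub/pxy.
  by have [Da Ea pa] := pp _ ap; split=> // b /sub/pa.
(* The new value is put between the values of the points below [x] and those of the points above
   [x]. *)
pose l := [seq a.2 | a <- p & lt a.1 x]; pose r := [seq a.2 | a <- p & lt x a.1].
have [|||y [Ey ly yr]] := @eta_sat _ _ _ oE l r.
- by move=> y /mapP[a]; rewrite mem_filter => /andP[_ /pp[]] _ ? _ ->.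
- by move=> y /mapP[a]; rewrite mem_filter => /andP[_ /pp[]] _ ? _ ->.
- move=> y z /mapP[a]; rewrite mem_filter => /andP[ax ap ->].
  move=> /mapP[b]; rewrite mem_filter => /andP[xb bp ->].
  have [Da Ea pa] := pp _ ap; have [Db Eb _] := pp _ bp.
  by rewrite -pa //; apply: (eta_trans oD _ Dx).
have ne a : a \in p -> [/\ lt a.1 x = lt' a.2 y & lt x a.1 = lt' y a.2].
  move=> ap; have [Da Ea _] := pp _ ap.
  have [ax|ax|xa] := eta_total oD Da Dx.
  - by case/negP: xNp; apply/mapP; exists a.
  - have ay : lt' a.2 y by apply: ly; apply/mapP; exists a; rewrite // mem_filter ax.
    by rewrite ax ay (eta_asym oD Da Dx ax) (eta_asym oE Ea Ey ay).
  - have ya : lt' y a.2 by apply: yr; apply/mapP; exists a; rewrite // mem_filter xa.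
    by rewrite xa ya (eta_asym oD Dx Da xa) (eta_asym oE Ey Ea ya).
exists y => a; rewrite inE => /predU1P[->|ap].
  split=> // b; rewrite inE => /predU1P[->|/ne[]//].
  by rewrite /= (eta_irr oD) // (eta_irr oE).
have [Da Ea pa] := pp _ ap; split=> // b; rewrite inE => /predU1P[->|/pa//].
by case: (ne _ ap).
Qed.

Section BackAndForth.
Variables (T U : countType) (D : set T) (E : set U) (lt : rel T) (lt' : rel U).
Hypotheses (oD : eta_order D lt) (oE : eta_order E lt').
Let ok := piso D E lt lt'.

Record iso_between (f : T -> U) (g : U -> T) : Prop := IsoBetween {
  iso_dom : forall x, D x -> E (f x);
  iso_cod : forall y, E y -> D (g y);
  isoK : forall x, D x -> g (f x) = x;
  isoVK : forall y, E y -> f (g y) = y;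
  iso_lt : forall x x', D x -> D x' -> lt x x' = lt' (f x) (f x') }.

(** Back and forth with further requirements [C n] interleaved, by which a generic automorphism is
    later made to avoid cosets. *)
Lemma generic_iso (C : nat -> set (seq (T * U))) p :
  (forall n p, ok p -> exists q, [/\ ok q, {subset p <= q} & C n q]) ->
  ok p -> exists f g, [/\ iso_between f g,
    {in p, forall a, f a.1 = a.2} &
    forall n, exists2 q, C n q & {in q, forall a, f a.1 = a.2}].
Proof.
move=> denseC okp.
pose Cx x (q : seq (T * U)) := D x -> exists y, (x, y) \in q.
pose Cy y (q : seq (T * U)) := E y -> exists x, (x, y) \in q.
pose CT n q := oapp (fun x => Cx x q) True (unpickle n).
pose CU n q := oapp (fun y => Cy y q) True (unpickle n).
pose C' n q := [/\ C n q, CT n q & CU n q].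
have forth x q : ok q -> exists r, [/\ ok r, {subset q <= r} & Cx x r].
  move=> okq; have [Dx|nD] := pselect (D x); last by exists q; split.
  have [y okr] := piso_forth oD oE okq Dx; exists ((x, y) :: q); split=> //.
    by move=> a aq; rewrite inE aq orbT.
  by exists y; rewrite mem_head.
have back y q : ok q -> exists r, [/\ ok r, {subset q <= r} & Cy y r].
  move=> okq; have [Ey|nD] := pselect (E y); last by exists q; split.
  have [x /piso_swap okr] := piso_forth oE oD (piso_swap okq) Ey.
  exists ((x, y) :: q); split.
  - by move: okr; rewrite /= -map_comp map_id_in // => -[].
  - by move=> a aq; rewrite inE aq orbT.
  by exists x; rewrite mem_head.
have denseC' n q : ok q -> exists r, [/\ ok r, {subset q <= r} & C' n r].
  move=> okq.
  have [r1 [ok1 s1 C1]] : exists r, [/\ ok r, {subset q <= r} & CT n r].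
    by rewrite /CT; case: unpickle => [x|]; [exact: forth|exists q; split].
  have [r2 [ok2 s2 C2]] : exists r, [/\ ok r, {subset r1 <= r} & CU n r].
    by rewrite /CU; case: unpickle => [x|]; [exact: back|exists r1; split].
  (* [C n] is met last, as it may fail to survive extension, whereas [CT] and [CU] do survive. *)
  have [r3 [ok3 s3 C3]] := denseC n _ ok2; exists r3; split=> //.
    by move=> a /s1/s2/s3.
  split=> //.
    by move: C1; rewrite /CT; case: unpickle => //= x Cx1 /Cx1[y /s2/s3]; exists y.
  by move: C2; rewrite /CU; case: unpickle => //= x Cx1 /Cx1[y /s3]; exists y.
have subxx (q : seq (T * U)) : {subset q <= q} by [].
have sub_trans (q r t : seq (T * U)) :
  {subset q <= r} -> {subset r <= t} -> {subset q <= t} by move=> qr rt a /qr/rt.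
have [s [s0 oks sC smono]] := generic_chain subxx sub_trans denseC' okp.
have com a b m n : a \in s m -> b \in s n ->
    [/\ D a.1, E a.2, D b.1, E b.2 & lt a.1 b.1 = lt' a.2 b.2].
  move=> /(smono _ _ (leq_maxl m n)) am /(smono _ _ (leq_maxr m n)) bn.
  by have [? ? ab] := oks _ _ am; have [? ? _] := oks _ _ bn; rewrite ab.
have fun1 a b m n : a \in s m -> b \in s n -> a.1 = b.1 -> a.2 = b.2.
  move=> am bn ab; have [Da Ea Db Eb abE] := com _ _ _ _ am bn.
  have [_ _ _ _ baE] := com _ _ _ _ bn am.
  move: abE baE; rewrite ab (eta_irr oD) // => abE baE.
  by case: (eta_total oE Ea Eb) => //; rewrite -?abE -?baE.
have fun2 a b m n : a \in s m -> b \in s n -> a.2 = b.2 -> a.1 = b.1.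
  move=> am bn ab; have [Da Ea Db Eb abE] := com _ _ _ _ am bn.
  have [_ _ _ _ baE] := com _ _ _ _ bn am.
  move: abE baE; rewrite ab (eta_irr oE) // => abE baE.
  by case: (eta_total oD Da Db) => //; rewrite ?abE ?baE.
have [d _] : exists d, [/\ D d, {in [::], forall x, lt x d} & {in [::], forall x, lt d x}].
  by apply: (eta_sat oD).
have [e _] : exists e, [/\ E e, {in [::], forall x, lt' x e} & {in [::], forall x, lt' e x}].
  by apply: (eta_sat oE).
have tot1 x : D x -> exists y n, (x, y) \in s n.
  move=> Dx; have [_ + _] := sC (pickle x).
  by rewrite /CT pickleK /= => /(_ Dx)[y ys]; exists y, (pickle x).+1.
have tot2 y : E y -> exists x n, (x, y) \in s n.
  move=> Ey; have [_ _ +] := sC (pickle y).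
  by rewrite /CU pickleK /= => /(_ Ey)[x xs]; exists x, (pickle y).+1.
have /choice[f fP] : forall x, exists y, D x -> exists n, (x, y) \in s n.
  move=> x; have [/tot1[y yP]|] := pselect (D x); first by exists y.
  by exists e.
have /choice[g gP] : forall y, exists x, E y -> exists n, (x, y) \in s n.
  move=> y; have [/tot2[x xP]|] := pselect (E y); first by exists x.
  by exists d.
have fD x : D x -> E (f x) by move=> /fP[n xs]; have [] := oks _ _ xs.
have gE y : E y -> D (g y) by move=> /gP[n xs]; have [] := oks _ _ xs.
have fs a n : a \in s n -> f a.1 = a.2.
  move=> an; have [Da _ _] := oks _ _ an; have [m fm] := fP _ Da.
  exact: (fun1 _ _ _ _ fm an).
exists f, g; split; first split=> //.
- move=> x Dx; have [n xn] := fP _ Dx; have [m xm] := gP _ (fD _ Dx).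
  exact: (fun2 _ _ _ _ xm xn).
- move=> y Ey; have [n xn] := gP _ Ey; have [m xm] := fP _ (gE _ Ey).
  exact: (fun1 _ _ _ _ xm xn).
- move=> x x' Dx Dx'; have [n xn] := fP _ Dx; have [m xm] := fP _ Dx'.
  by have [_ _ _ _] := com _ _ _ _ xn xm.
- by move=> a ap; apply: (fs _ 0%N); rewrite s0.
- by move=> n; exists (s n.+1); [case: (sC n)|move=> a /fs].
Qed.

Lemma extend_iso p : ok p -> exists f g,
  iso_between f g /\ {in p, forall a, f a.1 = a.2}.
Proof.
move=> okp; have [|f [g [fg fp _]]] := @generic_iso (fun _ _ => True) p _ okp.
  by move=> n q okq; exists q; split.
by exists f, g.
Qed.

End BackAndForth.

(** * Automorphisms of the linear order of the rationals *)

(** The inverse map is stored, so that the group inverse involves no choice; by [oautP] equality is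
    still equality of functions. *)
Record oaut : Type := OAut {
  oaut_fun :> rat -> rat;
  oaut_inv : rat -> rat;
  oaut_funK : cancel oaut_fun oaut_inv;
  oaut_invK : cancel oaut_inv oaut_fun;
  oaut_lt : {mono oaut_fun : x y / x < y} }.

HB.instance Definition _ := gen_eqMixin oaut.
HB.instance Definition _ := gen_choiceMixin oaut.

Lemma oautP (g h : oaut) : g =1 h -> g = h.
Proof.
case: g h => [g g' gK g'K gm] [h h' hK h'K hm] /= /funext gh.
rewrite -{h}gh in hK h'K hm *.
have e : g' = h' by apply/funext => x; rewrite -[x in g' x]h'K gK.
rewrite -{h'}e in hK h'K *.
by congr OAut; apply: Prop_irrelevance.
Qed.

Definition oaut_one : oaut :=
  @OAut idfun idfun (fun=> erefl) (fun=> erefl) (fun _ _ => erefl).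
Definition oaut_mul (g h : oaut) : oaut :=
  @OAut (g \o h) (oaut_inv h \o oaut_inv g)
    (can_comp (@oaut_funK g) (@oaut_funK h))
    (can_comp (@oaut_invK h) (@oaut_invK g))
    (fun x y => etrans (oaut_lt g (h x) (h y)) (oaut_lt h x y)).
Fact oaut_inv_lt (g : oaut) : {mono oaut_inv g : x y / x < y}.
Proof. by move=> x y; rewrite -(oaut_lt g) !oaut_invK. Qed.
Definition oaut_opp (g : oaut) : oaut :=
  OAut (@oaut_invK g) (@oaut_funK g) (oaut_inv_lt g).

Fact oaut_mulA : associative oaut_mul. Proof. by move=> f g h; apply: oautP. Qed.
Fact oaut_mul1g : left_id oaut_one oaut_mul. Proof. by move=> g; apply: oautP. Qed.
Fact oaut_mulg1 : right_id oaut_one oaut_mul. Proof. by move=> g; apply: oautP. Qed.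
Fact oaut_mulVg : left_inverse oaut_one oaut_opp oaut_mul.
Proof. by move=> g; apply: oautP => x /=; rewrite oaut_funK. Qed.
Fact oaut_mulgV : right_inverse oaut_one oaut_opp oaut_mul.
Proof. by move=> g; apply: oautP => x /=; rewrite oaut_invK. Qed.

HB.instance Definition _ := isGroup.Build oaut
  oaut_mulA oaut_mul1g oaut_mulg1 oaut_mulVg oaut_mulgV.

Lemma oautM (g h : oaut) x : (g * h) x = g (h x). Proof. by []. Qed.
Lemma oaut1 x : (1 : oaut) x = x. Proof. by []. Qed.
Lemma oautK (g : oaut) : cancel g (g^-1)%g.
Proof. by move=> x; rewrite -oautM mulVg. Qed.
Lemma oautVK (g : oaut) : cancel (g^-1)%g g.
Proof. by move=> x; rewrite -oautM mulgV. Qed.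
Lemma oaut_inj (g : oaut) : injective g.
Proof. exact: can_inj (oautK g). Qed.
Lemma oaut_le (g : oaut) : {mono g : x y / x <= y}.
Proof. by move=> x y; rewrite !leNgt oaut_lt. Qed.

(** * Supports, gluing and restriction of automorphisms *)

Definition supp (g : oaut) (B : set rat) := forall x, ~ B x -> g x = x.

Section Supp.
Implicit Types (g h : oaut) (B C : set rat).

Lemma supp1 B : supp 1 B. Proof. by []. Qed.

Lemma suppM g h B : supp g B -> supp h B -> supp (g * h) B.
Proof. by move=> gB hB x Bx; rewrite oautM hB // gB. Qed.

Lemma suppV g B : supp g B -> supp g^-1 B.
Proof. by move=> gB x Bx; rewrite -{1}(gB x Bx) oautK. Qed.

Lemma suppS g B C : (forall x, B x -> C x) -> supp g B -> supp g C.
Proof. by move=> BC gB x nC; apply: gB => /BC. Qed.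

Lemma supp_in g B x : supp g B -> B x -> B (g x).
Proof.
move=> gB Bx; have [//|nB] := pselect (B (g x)).
by have /oaut_inj gx := gB _ nB; rewrite gx in nB.
Qed.

Lemma supp_inV g B x : supp g B -> B (g x) -> B x.
Proof. by move=> gB /(supp_in (suppV gB)); rewrite oautK. Qed.

Lemma supp_conj g h B C : (forall x, B (h^-1 x) -> C x) ->
  supp g B -> supp (h * g * h^-1) C.
Proof.
by move=> BC gB x nC; rewrite !oautM gB ?oautVK // => /BC.
Qed.

Lemma supp_commute g h B C : (forall x, B x -> C x -> False) ->
  supp g B -> supp h C -> g * h = h * g.
Proof.
move=> BC gB hC; apply: oautP => x; rewrite !oautM.
have [Bx|nB] := pselect (B x).
  by rewrite (hC x) ?(hC (g x)) => [//|/(BC _ (supp_in gB Bx))|/(BC _ Bx)].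
have [Cx|nC] := pselect (C x); last by rewrite hC // gB // hC.
by rewrite (gB x) // gB // => /BC; apply; apply: supp_in.
Qed.

End Supp.

Definition disjoint_family (I : Type) (B : I -> set rat) :=
  forall i j x, B i x -> B j x -> i = j.

Definition is_glue (I : Type) (B : I -> set rat) (v : I -> oaut) (g : oaut) :=
  (forall i x, B i x -> g x = v i x) /\ supp g (fun x => exists i, B i x).

(* Any two of the [v i] act on their supports like their product, so no
   hypothesis relates the [B i] to the order. *)
Lemma glue_exists (I : Type) (B : I -> set rat) (v : I -> oaut) :
  disjoint_family B -> (forall i, supp (v i) (B i)) -> exists g, is_glue B v g.
Proof.
move=> dB vB.
pose F (w : I -> oaut) x :=
  if pselect (exists i, B i x) is left e then w (projT1 (cid e)) x else x.
have FE (w : I -> oaut) i x : B i x -> F w x = w i x.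
  move=> Bx; rewrite /F; case: pselect => [e|[]]; last by exists i.
  by case: cid => j /= Bj; rewrite (dB _ _ _ Bx Bj).
have FN w x : ~ (exists i, B i x) -> F w x = x.
  by move=> nB; rewrite /F; case: pselect.
have FK (w w' : I -> oaut) : (forall i, supp (w i) (B i)) -> (forall i x, w' i (w i x) = x) ->
    cancel (F w) (F w').
  move=> wB ww' x; have [[i Bx]|nB] := pselect (exists i, B i x); last by rewrite !FN.
  by rewrite (FE w i) // (FE w' i) ?ww' //; apply: supp_in.
have vV i : supp (v i)^-1 (B i) by apply: suppV.
have Fm : {mono F v : x y / x < y}.
  move=> x y.
  have [[i Bx]|nBx] := pselect (exists i, B i x); last first.
    rewrite (FN _ x) //.
    have [[j By]|nBy] := pselect (exists i, B i y); last by rewrite FN.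
    rewrite (FE _ j) // -[in LHS](vB j x) ?oaut_lt // => Bx.
    by apply: nBx; exists j.
  rewrite (FE _ i) //.
  have [[j By]|nBy] := pselect (exists i, B i y); last first.
    rewrite FN // -[in LHS](vB i y) ?oaut_lt // => By.
    by apply: nBy; exists i.
  rewrite (FE _ j) //.
  have [By'|nBy] := pselect (B i y); first by rewrite (dB _ _ _ By By') oaut_lt.
  rewrite -[v j y](vB i); last by move=> /(dB _ _ _ (supp_in (vB j) By)) ij; rewrite -ij in nBy.
  rewrite oaut_lt -[in LHS](vB j x) ?oaut_lt // => Bx'.
  by rewrite (dB _ _ _ Bx Bx') in nBy.
exists (OAut (FK v (fun i => (v i)^-1) vB (fun i => oautK (v i)))
  (FK (fun i => (v i)^-1) v vV (fun i => oautVK (v i))) Fm).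
by split=> [i x Bx|x nB]; [apply: FE|apply: FN].
Qed.

Lemma is_glueV (I : Type) (B : I -> set rat) (v : I -> oaut) g :
  (forall i, supp (v i) (B i)) -> is_glue B v g -> is_glue B (fun i => (v i)^-1) g^-1.
Proof.
move=> vB [gv gB]; split; last exact: suppV.
move=> i x Bx; apply: (@oaut_inj g); rewrite oautVK (gv i) ?oautVK //.
by apply: supp_in Bx; apply: suppV.
Qed.

Lemma is_glueM (I : Type) (B : I -> set rat) (v w : I -> oaut) g h :
  (forall i, supp (w i) (B i)) ->
  is_glue B v g -> is_glue B w h -> is_glue B (fun i => v i * w i) (g * h).
Proof.
move=> wB [gv gB] [hv hB]; split; last exact: suppM.
by move=> i x Bx; rewrite !oautM (hv i) // (gv i) //; apply: supp_in.
Qed.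

(** A fixed point of [g] lies between any point of [U] and any point off [U], the latter included.
    Hence [g] on [U], completed by the identity, preserves the order. *)
Definition separated (g : oaut) (U : set rat) := forall x y, U x -> ~ U y ->
  (x < y -> exists2 z, g z = z & x < z <= y) /\
  (y < x -> exists2 z, g z = z & y <= z < x).

Lemma separatedV g U : separated g U -> separated g^-1 U.
Proof.
by move=> gU x y Ux Uy; have [h1 h2] := gU x y Ux Uy;
  split=> [/h1|/h2] [z gz xzy]; exists z => //; rewrite -{1}gz oautK.
Qed.

Lemma separated_in g U x : separated g U -> U x -> U (g x).
Proof.
move=> gU Ux; have [//|nU] := pselect (U (g x)).
have [h1 h2] := gU _ _ Ux nU; case: (ltgtP x (g x)) => [xg|gx|e].
- have [z gz /andP[xz zg]] := h1 xg.
  by move: zg; rewrite -gz oaut_le leNgt xz.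
- have [z gz /andP[gz' zx]] := h2 gx.
  by move: gz'; rewrite -gz oaut_le leNgt zx.
- by rewrite -e in nU.
Qed.

Lemma restriction_exists g U : separated g U ->
  exists h : oaut, (forall x, U x -> h x = g x) /\ supp h U.
Proof.
move=> gU; have gVU := separatedV gU.
pose F (g : oaut) x := if pselect (U x) is left _ then g x else x.
have FE k x : U x -> F k x = k x by rewrite /F; case: pselect.
have FN k x : ~ U x -> F k x = x by rewrite /F; case: pselect.
have FK k : separated k U -> cancel (F k) (F (k^-1)%g).
  move=> kU x; have [Ux|nU] := pselect (U x); last by rewrite !FN.
  by rewrite (FE k) // FE ?oautK //; apply: separated_in.
have FVK : cancel (F (g^-1)%g) (F g) by rewrite -{2}[g]invgK; apply: FK.
have lt1 x y : U x -> ~ U y -> (g x < y) = (x < y).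
  move=> Ux Uy; have [h1 h2] := gU _ _ Ux Uy; apply/idP/idP => [gxy|/h1[z gz /andP[xz zy]]].
    case: (ltgtP x y) => // [/h2[z gz /andP[yz zx]]|xy]; last by rewrite xy in Ux.
    by move: (lt_le_trans gxy yz); rewrite -[z]gz oaut_lt ltNge (ltW zx).
  by apply: lt_le_trans zy; rewrite -[z]gz oaut_lt.
have Fm : {mono F g : x y / x < y}.
  move=> x y; have [Ux|nUx] := pselect (U x); have [Uy|nUy] := pselect (U y).
  - by rewrite !FE // oaut_lt.
  - by rewrite FE // FN // lt1.
  - rewrite FN // FE //; have := lt1 _ _ Uy nUx.
    by case: (ltgtP x y) => [xy|yx|e]; case: (ltgtP x (g y)) => // e';
      [rewrite e' in nUx; case: nUx; apply: separated_in|rewrite e in nUx].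
  - by rewrite !FN.
exists (OAut (FK g gU) FVK Fm); split=> /= x; first exact: FE.
exact: FN.
Qed.

(** * Open convex sets and moving points inside them *)

Definition ival (a b : rat) : set rat := [set x | a < x < b].

(** Intervals without endpoints, described without naming their ends, which may be irrational or
    infinite. *)
Record open_convex (J : set rat) : Prop := OpenConvex {
  oc_ex : exists x, J x;
  oc_conv : forall x y z, J x -> J y -> x < z < y -> J z;
  oc_lo : forall x, J x -> exists2 y, J y & y < x;
  oc_hi : forall x, J x -> exists2 y, J y & x < y }.

Lemma rat_dense (x y : rat) : x < y -> exists z, x < z < y.
Proof. by move=> xy; exists ((x + y) / 2%:R)%R; rewrite !(midf_lt xy). Qed.

Lemma open_convexT : open_convex setT.
Proof.
split=> // [|x _|x _]; first by exists 0%R.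
  by exists (x - 1)%R => //; rewrite ltrBlDr ltrDl.
by exists (x + 1)%R => //; rewrite ltrDl.
Qed.

Lemma open_convex_ival a b : a < b -> open_convex (ival a b).
Proof.
move=> ab; split=> [|x y z /andP[ax _] /andP[_ yb] /andP[xz zy]|x /andP[ax xb]|x /andP[ax xb]].
- by have [z ?] := rat_dense ab; exists z.
- by rewrite /ival /= (lt_trans ax) ?(lt_trans zy).
- have [z /andP[az zx]] := rat_dense ax; exists z => //.
  by rewrite /ival /= az (lt_trans zx).
- have [z /andP[xz zb]] := rat_dense xb; exists z => //.
  by rewrite /ival /= zb (lt_trans ax).
Qed.

Lemma eta_open_convex J : open_convex J -> eta_order J (fun x y : rat => x < y).
Proof.
move=> oJ; apply: eta_order_dense => [x _|x y z _ _ _|x y _ _||||x y Jx Jy xy].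
- by rewrite ltxx.
- exact: lt_trans.
- by case: (ltgtP x y) => [xy|yx|->]; [constructor 2|constructor 3|constructor 1].
- exact: oc_ex.
- exact: oc_lo.
- exact: oc_hi.
- have [z /[dup] xzy /andP[xz zy]] := rat_dense xy; exists z; split=> //.
  exact: oc_conv xzy.
Qed.

Notation rat_piso J := (piso J J (fun x y : rat => x < y) (fun x y : rat => x < y)).

Lemma extend_oaut J p : open_convex J -> rat_piso J p ->
  exists2 g : oaut, supp g J & {in p, forall a, g a.1 = a.2}.
Proof.
move=> oJ okp; have oJ' := eta_open_convex oJ.
have [f [f' [[fJ f'J fK f'K flt] fp]]] := extend_iso oJ' oJ' okp.
pose F (f : rat -> rat) x := if pselect (J x) is left _ then f x else x.
have FE k x : J x -> F k x = k x by rewrite /F; case: pselect.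
have FN k x : ~ J x -> F k x = x by rewrite /F; case: pselect.
have FK k k' : (forall x, J x -> J (k x)) -> (forall x, J x -> k' (k x) = x) ->
    cancel (F k) (F k').
  move=> kJ kK x; have [Jx|nJ] := pselect (J x); last by rewrite !FN.
  by rewrite (FE k) // FE ?kK //; apply: kJ.
(* A point outside the convex set [J] lies on the same side of all points of [J]. *)
have cmp x y y' : J y -> J y' -> ~ J x -> ((x < y) = (x < y')) * ((y < x) = (y' < x)).
  move=> Jy Jy' nJx; have b y1 y2 : J y1 -> J y2 -> y1 < x -> x < y2 -> False.
    by move=> J1 J2 yx xy; apply: nJx; apply: (oc_conv oJ J1 J2); rewrite yx.
  split; case: (ltgtP x y) => [xy|yx|e]; case: (ltgtP x y') => [xy'|yx'|e'] //;
    do ?[by case: (b y y')|by case: (b y' y)|by rewrite e in nJx|by rewrite e' in nJx].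
have Fm : {mono F f : x y / x < y}.
  move=> x y; have [Jx|nJx] := pselect (J x); have [Jy|nJy] := pselect (J y).
  - by rewrite !FE // [RHS]flt.
  - by rewrite FE // FN // (cmp y _ _ (fJ _ Jx) Jx nJy).
  - by rewrite FN // FE // (cmp x _ _ (fJ _ Jy) Jy nJx).
  - by rewrite !FN.
exists (OAut (FK f f' fJ fK) (FK f' f f'J f'K) Fm) => [x /= /FN-> //|a ap /=].
by rewrite FE ?fp //; case: (okp _ ap).
Qed.

Lemma piso1 J x x' : J x -> J x' -> rat_piso J [:: (x, x')].
Proof. by move=> Jx Jx' a; rewrite inE => /eqP-> /=; split=> // b; rewrite inE => /eqP->; rewrite /= !ltxx. Qed.

Lemma piso2 J x x' y y' : J x -> J x' -> J y -> J y' -> x < y -> x' < y' ->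
  rat_piso J [:: (x, x'); (y, y')].
Proof.
move=> Jx Jx' Jy Jy' xy xy' a; rewrite !inE => /orP[]/eqP-> /=; split=> // b;
  rewrite !inE => /orP[]/eqP->; rewrite /= ?ltxx ?xy ?xy' //.
by rewrite !ltNge !ltW.
Qed.

Lemma move1 J x x' : open_convex J -> J x -> J x' ->
  exists2 g : oaut, supp g J & g x = x'.
Proof.
move=> oJ Jx Jx'; have [g gJ gx] := extend_oaut oJ (piso1 Jx Jx').
by exists g => //; apply: (gx (x, x')); rewrite mem_head.
Qed.

Lemma move2 J x x' y y' : open_convex J -> J x -> J x' -> J y -> J y' ->
  x < y -> x' < y' -> exists2 g : oaut, supp g J & g x = x' /\ g y = y'.
Proof.
move=> oJ Jx Jx' Jy Jy' xy xy'.
have [g gJ gp] := extend_oaut oJ (piso2 Jx Jx' Jy Jy' xy xy').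
exists g => //; split; first by apply: (gp (x, x')); rewrite mem_head.
by apply: (gp (y, y')); rewrite !inE eqxx orbT.
Qed.

Lemma oaut_ival (g : oaut) a b x : ival (g a) (g b) (g x) <-> ival a b x.
Proof. by rewrite /ival /= !oaut_lt. Qed.

(** * Subgroups of countable index *)

Definition cup (a b : nat -> rat) : set rat :=
  [set x | exists n, ival (a n) (b n) x].

Lemma increasing_between (a b : rat) : a < b -> exists s : nat -> rat,
  (forall n, a < s n < b) /\ (forall n, s n < s n.+1).
Proof.
move=> ab; have /choice[f fP] : forall x, exists y, x < b -> x < y < b.
  move=> x; have [/rat_dense[y]|_] := boolP (x < b); first by exists y.
  by exists x.
pose s n := iter n f (f a).
have sab n : a < s n < b.
  elim: n => [|n /andP[an nb]]; first exact: fP.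
  by have /andP[nf ->] := fP _ nb; rewrite (lt_trans an nf).
by exists s; split=> // n; have /andP[_ /fP/andP[]] := sab n.
Qed.

Lemma increasing_mono (s : nat -> rat) : (forall n, s n < s n.+1) ->
  forall m n, (m <= n)%N -> s m <= s n.
Proof.
move=> sS m n /subnK<-; elim: (n - m)%N => [|k IHk]; first by rewrite add0n.
by rewrite addSn (le_trans IHk) // ltW.
Qed.

Lemma increasing_steps (s : nat -> rat) : (forall n, s n < s n.+1) ->
  disjoint_family (fun n => ival (s n) (s n.+1)).
Proof.
move=> sS m n x /andP[mx xm] /andP[nx xn].
have le i j : s i < x -> x < s j.+1 -> (i <= j)%N.
  move=> ix xj; rewrite leqNgt; apply/negP => /(increasing_mono sS) ji.
  by move: (lt_trans ix (lt_le_trans xj ji)); rewrite ltxx.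
by apply/eqP; rewrite eqn_leq !le.
Qed.

Lemma disjoint_family_sub (I : Type) (B C : I -> set rat) :
  (forall i x, B i x -> C i x) -> disjoint_family C -> disjoint_family B.
Proof. by move=> BC dC i j x /BC Ci /BC Cj; apply: dC Ci Cj. Qed.

Lemma ivalS (a b c d x : rat) : c <= a -> b <= d -> ival a b x -> ival c d x.
Proof.
move=> ca bd /andP[ax xb]; rewrite /ival /=.
by rewrite (le_lt_trans ca ax) (lt_le_trans xb bd).
Qed.

Lemma move_all (a x x' y y' b : nat -> rat) :
  disjoint_family (fun n => ival (a n) (b n)) ->
  (forall n, [/\ a n < x n, x n < y n & y n < b n]) ->
  (forall n, [/\ a n < x' n, x' n < y' n & y' n < b n]) ->
  exists g : oaut, [/\ supp g (cup a b),
    forall n, g (x n) = x' n /\ g (y n) = y' n &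
    forall n z, ival (a n) (b n) z -> ival (a n) (b n) (g z)].
Proof.
move=> dK xy xy'.
have /choice[v vP] : forall n, exists g : oaut,
    supp g (ival (a n) (b n)) /\ (g (x n) = x' n /\ g (y n) = y' n).
  move=> n; have [ax lxy yb] := xy n; have [ax' lxy' yb'] := xy' n.
  have ab : a n < b n by apply: lt_trans (lt_trans ax lxy) yb.
  have [||||g] := @move2 (ival (a n) (b n)) (x n) (x' n) (y n) (y' n)
    (open_convex_ival ab) _ _ _ _ lxy lxy'; last by exists g.
  - by rewrite /ival /= ax (lt_trans lxy).
  - by rewrite /ival /= ax' (lt_trans lxy').
  - by rewrite /ival /= yb (lt_trans ax).
  - by rewrite /ival /= yb' (lt_trans ax').
have [g [gv gs]] := glue_exists dK (fun n => (vP n).1).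
exists g; split=> // [n|n z nz].
  have [ax lxy yb] := xy n.
  rewrite !(gv n); first by case: (vP n).
    by rewrite /ival /= yb (lt_trans ax).
  by rewrite /ival /= ax (lt_trans lxy).
by rewrite (gv n) //; apply: supp_in => //; case: (vP n).
Qed.

(* [g = [w, t]] where [w] is the product of the conjugates of [g] by all the
   powers of [t]. *)
Lemma displaced_commutator (g t : oaut) (C E : set rat) :
  supp t E -> (forall x, C x -> E x) ->
  disjoint_family (fun n x => C ((t ^+ n)^-1 x)) -> supp g C ->
  exists2 w, supp w E & g = w * t * w^-1 * t^-1.
Proof.
move=> tE CE dT gC.
have tnE n : supp (t ^+ n) E.
  by elim: n => [|n IHn] x nE; rewrite ?expgS ?oautM ?IHn ?tE.
have vT n : supp (t ^+ n * g * (t ^+ n)^-1) (fun x => C ((t ^+ n)^-1 x)).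
  exact: supp_conj gC.
have [w [wv wT]] := glue_exists dT vT.
exists w.
  apply: suppS wT => x [n] /CE; apply: supp_inV.
  exact: suppV.
apply: (canRL (mulgK _)); apply: (canRL (mulgK _)).
(* The identity now reads [g * t * w = w * t]. The cases are: [t x] lies in [C]; [x] lies in a
   translate of [C] by a power of [t]; neither holds. *)
apply: oautP => x; rewrite !oautM.
have [Cx|nCx] := pselect (C (t x)).
  rewrite (wv 0%N (t x)); last by rewrite expg0 invg1 oaut1.
  rewrite expg0 invg1 !oautM !oaut1 wT // => -[n Cn]; have := dT 0%N n.+1 (t x).
  rewrite expg0 invg1 oaut1 expgS invgM oautM oautK.
  by move=> /(_ Cx Cn).
have [[n Cn]|nC] := pselect (exists n, C ((t ^+ n)^-1 x)).
  rewrite (wv n.+1 (t x)); last by rewrite expgS invgM oautM oautK.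
  rewrite (wv n x) // expgS invgM !oautM oautK gC //.
  apply: contra_not nCx => Cw; exfalso.
  set y := t (_) in Cw.
  have Cy : C ((t ^+ n.+1)^-1 y).
    rewrite /y expgS invgM oautM oautK oautK.
    exact: supp_in.
  by have := dT 0%N n.+1 y; rewrite expg0 invg1 oaut1 => /(_ Cw Cy).
rewrite (wT x) // (wT (t x)) ?gC // => -[[|n]].
  by rewrite expg0 invg1 oaut1.
by rewrite expgS invgM oautM oautK => Cn; apply: nC; exists n.
Qed.

(** Countable index is expressed by a numbering of the group in which elements with equal codes lie
    in the same left coset, so no quotient is formed. *)
Record ctbl_index (H : set oaut) : Prop := CtblIndex {
  ctbl1 : H 1;
  ctblM : forall g h, H g -> H h -> H (g * h);
  ctblV : forall g, H g -> H g^-1;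
  ctbl_code : exists c : oaut -> nat, forall g h, c g = c h -> H (g^-1 * h) }.

Section SmallIndex.
Variable H : set oaut.
Hypothesis cH : ctbl_index H.

Definition fixes_off (B : set rat) := forall g, supp g B -> H g.

(** The elements of [H] realise every automorphism supported on [B], with no control over what they
    do off [B]. *)
Definition full (B : set rat) := forall u, supp u B ->
  exists2 h, H h & forall x, B x -> h x = u x.

Lemma fixes_offS B C : (forall x, B x -> C x) -> fixes_off C -> fixes_off B.
Proof. by move=> BC HC g gB; apply/HC/(suppS BC). Qed.

(* Otherwise a diagonal glueing would avoid every coset of [H]. *)
Lemma full_component (B : nat -> set rat) : disjoint_family B ->
  exists m, forall u, supp u (B m) ->
  exists h v, [/\ H h, is_glue B v h, forall i, supp (v i) (B i) & v m = u].
Proof.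
move=> dB; have [c cP] := ctbl_code cH; apply: contrapT => nf.
have /choice[u uP] : forall m, exists u, supp u (B m) /\
    ~ exists h v, [/\ H h, is_glue B v h, forall i, supp (v i) (B i) & v m = u].
  move=> m; apply: contrapT => nu; apply: nf; exists m => u uB.
  by apply: contrapT => nh; apply: nu; exists u.
pose codes k r := exists2 g, is_glue B r g & c g = k.
(* [r k] is local data with a glueing of code [k] when such data exist, and the identity
   otherwise. *)
have /choice[r rP] : forall k, exists r : nat -> oaut,
    (forall i, supp (r i) (B i)) /\
    forall w, (forall i, supp (w i) (B i)) -> codes k w -> codes k r.
  move=> k; have [[w [wB kw]]|nw] :=
      pselect (exists w, (forall i, supp (w i) (B i)) /\ codes k w).
    by exists w.
  by exists (fun=> 1); split=> [i|w wB kw]; [apply: supp1|case: nw; exists w].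
(* The diagonal family. If its glueing has code [m], so has some glueing of [r m]; their quotient
   lies in [H] and is [u m] on [B m], a contradiction. *)
pose w m := r m m * u m.
have wB i : supp (w i) (B i) by apply: suppM; [case: (rP i)|case: (uP i)].
have [g gw] := glue_exists dB wB.
have [rB rk] := rP (c g).
have [g' g'r cg'] : codes (c g) (r (c g)) by apply: (rk w) => //; exists g.
case: (uP (c g)) => _; apply.
exists (g'^-1 * g), (fun i => (r (c g) i)^-1 * w i); split.
- exact: cP.
- by apply: is_glueM => //; apply: is_glueV.
- by move=> i; apply: suppM => //; apply: suppV.
- by rewrite mulKg.
Qed.

(** Some [h1] in [H] agrees with [f] on [B], and some [h2] in [H], supported in [B], agrees with [g]
    on [E k]. The error of [h1] lives off [B] and commutes with [h2]; the error of [h2] lives off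
    [E k] and commutes with [f]. So [h1] and [h2] have the same commutator as [f] and [g]. *)
Lemma commutators_in (B : set rat) (E : nat -> set rat) :
  full B -> disjoint_family E -> (forall k x, E k x -> B x) ->
  exists k, forall f g, supp f (E k) -> supp g (E k) -> H (f * g * f^-1 * g^-1).
Proof.
move=> fB dE EB; have [k kP] := full_component dE; exists k => f g fE gE.
have [h2 [w [Hh2 [h2w h2E] wE wk]]] := kP g gE.
have [h1 Hh1 h1f] : exists2 h, H h & forall x, B x -> h x = f x.
  by apply: fB; apply: suppS fE => x; apply: EB.
pose f' : oaut := f^-1 * h1; pose g' : oaut := g^-1 * h2.
have f'B : supp f' (fun x => ~ B x).
  by move=> x /contrapT Bx; rewrite /f' oautM h1f // oautK.
have g'E : supp g' (fun x => ~ E k x).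
  by move=> x /contrapT Ex; rewrite /g' oautM (h2w k) // wk oautK.
have h2B : supp h2 B by apply: suppS h2E => x [i]; apply: EB.
have c1 : f' * h2 = h2 * f' by apply: (supp_commute _ f'B h2B).
have c2 : f * g' = g' * f by apply: supp_commute fE g'E => x Ex nEx.
suff -> : f * g * f^-1 * g^-1 = h1 * h2 * h1^-1 * h2^-1.
  by do !apply: (ctblM cH) => //; apply: (ctblV cH).
have h1E : h1 = f * f' by rewrite mulVKg.
have h2E' : h2 = g * g' by rewrite mulVKg.
clearbody f' g'; rewrite h1E -(mulgA f f') c1 invgM !mulgA mulgK.
have c3 : g' * f^-1 = f^-1 * g'.
  by apply: (mulgI f); rewrite !mulgA c2 mulgK mulgV mul1g.
by rewrite h2E' invgM !mulgA -(mulgA _ g') c3 !mulgA mulgK.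
Qed.

End SmallIndex.

(** * Tails of sequences of intervals *)

Section Tails.
Variable H : set oaut.
Hypothesis cH : ctbl_index H.

(* [b0 n, b1 n] is moved inside [k0 n, k1 n] to the [code (alpha|n)]-th term of
   a disjoint sequence of intervals. Distinct [alpha] give eventually disjoint
   images, and infinitely many of these displacements lie in one coset. *)
Lemma full_tail (k0 b0 b1 k1 : nat -> rat) :
  disjoint_family (fun n => ival (k0 n) (k1 n)) ->
  (forall n, [/\ k0 n < b0 n, b0 n < b1 n & b1 n < k1 n]) ->
  exists N, full H (cup (fun n => b0 (N + n)%N) (fun n => b1 (N + n)%N)).
Proof.
move=> dK bP; have [c cP] := ctbl_code cH.
have kk n : k0 n < k1 n by have [? ? ?] := bP n; apply: lt_trans (lt_trans _ _) _; eassumption.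
have /choice[s sP] := fun n => increasing_between (kk n).
have /choice[G GP] : forall alpha : nat -> nat, exists g : oaut, forall n,
    let j := pickle (mkseq alpha n) in g (b0 n) = s n j /\ g (b1 n) = s n j.+1.
  move=> alpha; pose j n := pickle (mkseq alpha n).
  have [//|n|g [_ gP _]] := @move_all k0 b0 (fun n => s n (j n)) b1 (fun n => s n (j n).+1) k1 dK.
    have [sb sS] := sP n; rewrite sS; split=> //.
      by case/andP: (sb (j n)).
    by case/andP: (sb (j n).+1).
  by exists g => n; apply: gP.
(* Baire category on sequences: for some prefix [p], every next value occurs with the same code [k].
   Otherwise a recursively built [alpha] would avoid its own code. *)
have [p [k pP]] : exists (p : seq nat) k, forall i, exists alpha : nat -> nat,
    [/\ mkseq alpha (size p) = p, alpha (size p) = i & c (G alpha) = k].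
  apply: contrapT => np.
  have /choice[i iP] : forall pk : seq nat * nat, exists i, forall alpha,
      mkseq alpha (size pk.1) = pk.1 -> alpha (size pk.1) = i -> c (G alpha) <> pk.2.
    move=> [p k]; apply: contrapT => ni; apply: np; exists p, k => i.
    apply: contrapT => na; apply: ni; exists i => alpha pa ia ck.
    by apply: na; exists alpha.
  pose S := fix S n := if n is m.+1 then rcons (S m) (i (S m, m)) else [::].
  pose alpha n := i (S n, n).
  have aS n : mkseq alpha n = S n.
    by elim: n => [//|n IHn]; rewrite /= /mkseq -addn1 iotaD map_cat /= -[map _ _]/(mkseq _ _) IHn cats1.
  have sS n : size (S n) = n by rewrite -aS size_mkseq.
  by apply: (iP (S (c (G alpha)), c (G alpha)) alpha) => //=; rewrite sS.
have /choice[A AP] := pP.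
(* From [N] terms on, the prefix of [A i] contains its entry [i] at position [size p], so distinct
   [i] use distinct slots. *)
pose N := (size p).+1; exists N.
set B := cup _ _.
pose h i : oaut := (G (A 0%N))^-1 * G (A i).
have Hh i : H (h i) by apply: cP; case: (AP 0%N) => _ _ ->; case: (AP i).
have AE i n : nth 0%N (mkseq (A i) (N + n)) (size p) = i.
  by rewrite nth_mkseq ?ltn_addr //; case: (AP i).
have place i x : B ((h i)^-1 x) -> exists n,
    let j := pickle (mkseq (A i) (N + n)) in ival (s (N + n)%N j) (s (N + n)%N j.+1) (G (A 0%N) x).
  rewrite /h invgM invgK oautM => -[n nx]; exists n => /=.
  have [<- <-] := GP (A i) (N + n)%N.
  by rewrite -[G (A 0%N) x](oautVK (G (A i))); apply/oaut_ival.
have dD : disjoint_family (fun i x => B ((h i)^-1 x)).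
  move=> i i' x /place[n nx] /place[n' nx'].
  have inK m j z : ival (s m j) (s m j.+1) z -> ival (k0 m) (k1 m) z.
    have [sb _] := sP m; apply: ivalS; first by case/andP: (sb j) => /ltW.
    by case/andP: (sb j.+1) => _ /ltW.
  have nn := dK _ _ _ (inK _ _ _ nx) (inK _ _ _ nx').
  move: nx nx' => /=; rewrite nn => nx nx'; have [_ sS] := sP (N + n')%N.
  have /(pcan_inj pickleK) e := increasing_steps sS nx nx'.
  by rewrite -(AE i n') e AE.
(* The component found is the image of [B] under [h m], and conjugating by [h m], which lies in [H],
   leads back to [B]. *)
have [m mP] := full_component cH dD; move=> u uB.
have uD : supp (h m * u * (h m)^-1) (fun x => B ((h m)^-1 x)) by apply: supp_conj uB.
have [h' [v [Hh' [h'v _] _ vm]]] := mP _ uD.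
exists ((h m)^-1 * h' * h m) => [|x Bx].
  by do ?apply: (ctblM cH) => //; apply: (ctblV cH).
by rewrite !oautM (h'v m) ?vm ?oautK // !oautM !oautK.
Qed.

(** In each interval a slot is found on which all commutators lie in [H]. Smaller intervals from
    [x n] to [y n] in the slots are displaced by some [t], so whatever is supported there is a
    commutator. Fullness gives an element of [H] carrying them onto the intervals from [c0 n] to
    [c1 n]. *)
Lemma full_fixes_off (b0 c0 c1 b1 : nat -> rat) :
  disjoint_family (fun n => ival (b0 n) (b1 n)) ->
  (forall n, [/\ b0 n < c0 n, c0 n < c1 n & c1 n < b1 n]) ->
  full H (cup b0 b1) -> fixes_off H (cup c0 c1).
Proof.
move=> dB cP fB.
have bb n : b0 n < b1 n by have [? ? ?] := cP n; apply: lt_trans (lt_trans _ _) _; eassumption.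
have /choice[e eP] := fun n => increasing_between (bb n).
pose E k := cup (fun n => e n k) (fun n => e n k.+1).
have eB n k z : ival (e n k) (e n k.+1) z -> ival (b0 n) (b1 n) z.
  have [eb _] := eP n; apply: ivalS; first by case/andP: (eb k) => /ltW.
  by case/andP: (eb k.+1) => _ /ltW.
have dE : disjoint_family E.
  move=> i j z [n zi] [m zj]; have nm := dB _ _ _ (eB _ _ _ zi) (eB _ _ _ zj).
  move: zj; rewrite -nm => zj; have [_ eS] := eP n.
  exact: increasing_steps eS _ _ _ zi zj.
have EB k z : E k z -> cup b0 b1 z by move=> [n /eB]; exists n.
have [k kP] := commutators_in cH fB dE EB.
have /choice[x xP] : forall n, exists x, e n k < x < e n k.+1.
  by move=> n; apply: rat_dense; case: (eP n).
have /choice[y yP] : forall n, exists y, x n < y < e n k.+1.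
  by move=> n; apply: rat_dense; case/andP: (xP n).
have /choice[z zP] : forall n, exists z, y n < z < e n k.+1.
  by move=> n; apply: rat_dense; case/andP: (yP n).
have dEk : disjoint_family (fun n => ival (e n k) (e n k.+1)).
  exact: disjoint_family_sub (fun n => eB n k) dB.
have [|n|t [tE txy tI]] := @move_all (fun n => e n k) x y y z _ dEk.
- by move=> n; case/andP: (xP n) => ? _; case/andP: (yP n) => ? ?; split.
- case/andP: (xP n) => ex _; case/andP: (yP n) => xy _; case/andP: (zP n) => yz ze.
  by split=> //; apply: lt_trans xy.
(* Each positive power of [t] pushes [x n] to [y n] or beyond, hence the whole small interval off
   itself. *)
have yI n i : y n <= (t ^+ i.+1) (x n).
  have ty : y n <= t (y n).
    have [_ ->] := txy n; case/andP: (zP n) => /ltW //.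
  elim: i => [|i IHi]; first by rewrite expg1; have [-> _] := txy n.
  by rewrite expgS oautM (le_trans ty) // oaut_le.
have tnI n i w : ival (e n k) (e n k.+1) w -> ival (e n k) (e n k.+1) ((t ^+ i) w).
  by elim: i w => [|i IHi] w //; rewrite expgS oautM => /IHi/tI.
have xye n w : ival (x n) (y n) w -> ival (e n k) (e n k.+1) w.
  by apply: ivalS; apply: ltW; [case/andP: (xP n)|case/andP: (yP n)].
have displaced i w : cup x y w -> cup x y ((t ^+ i.+1) w) -> False.
  move=> [n nw] [m mw].
  have nm := dEk _ _ _ (tnI _ i.+1 _ (xye _ _ nw)) (xye _ _ mw).
  move: mw; rewrite -nm => /andP[_]; rewrite ltNge => /negP; apply.
  by rewrite (le_trans (yI n i)) // oaut_le ltW //; case/andP: nw.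
have lt_displaced i j w : (i < j)%N ->
    cup x y ((t ^+ i)^-1 w) -> cup x y ((t ^+ j)^-1 w) -> False.
  move=> ij wi wj; apply: (displaced (j - i.+1)%N _ wj).
  have e' : t ^+ j = t ^+ i * t ^+ (j - i.+1).+1 by rewrite -expgnDr subnSK // subnKC // ltnW.
  suff <- : (t ^+ i)^-1 w = (t ^+ (j - i.+1).+1) ((t ^+ j)^-1 w) by [].
  by rewrite e' invgM oautM oautVK.
have dT : disjoint_family (fun n w => cup x y ((t ^+ n)^-1 w)).
  move=> i j w wi wj; case: (ltngtP i j) => // [ij|ji].
    by case: (lt_displaced _ _ _ ij wi wj).
  by case: (lt_displaced _ _ _ ji wj wi).
have goodxy : fixes_off H (cup x y).
  move=> g gC; have [//|w wE ->] := displaced_commutator tE _ dT gC; last exact: kP.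
  by move=> w [n /xye]; exists n.
have [|//|u [uB uxy _]] := @move_all b0 x c0 y c1 b1 dB.
  move=> n; have [eb _] := eP n; case/andP: (eb k) => be _; case/andP: (eb k.+1) => _ eb'.
  case/andP: (xP n) => ex _; case/andP: (yP n) => xy ye.
  by split=> //; [apply: lt_trans ex|apply: lt_trans eb'].
have [h Hh hu] := fB u uB.
move=> g gC.
have : H (h^-1 * g * h^-1^-1).
  apply: goodxy; apply: supp_conj gC => w; rewrite invgK => -[n nw].
  exists n; have [ux uy] := uxy n.
  have inB v : ival (e n k) (e n k.+1) v -> cup b0 b1 v by move=> /eB; exists n.
  have [xe ye] : ival (e n k) (e n k.+1) (x n) /\ ival (e n k) (e n k.+1) (y n).
    case/andP: (xP n) => ex xe; case/andP: (yP n) => xy ye.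
    by rewrite /ival /= ex xe ye (lt_trans ex xy).
  by apply/(oaut_ival h); rewrite (hu _ (inB _ xe)) (hu _ (inB _ ye)) ux uy.
rewrite invgK => Hg.
have -> : g = h * (h^-1 * g * h) * h^-1 by rewrite !mulgA mulgV mul1g mulgK.
by do ?apply: (ctblM cH) => //; apply: (ctblV cH).
Qed.

(** The two preceding lemmas each use up some room, whence three nested sequences of intervals. *)
Lemma tail_fixes_off (k0 b0 c0 c1 b1 k1 : nat -> rat) :
  disjoint_family (fun n => ival (k0 n) (k1 n)) ->
  (forall n, k0 n < b0 n < c0 n) -> (forall n, c0 n < c1 n) ->
  (forall n, c1 n < b1 n < k1 n) ->
  exists N, fixes_off H (cup (fun n => c0 (N + n)%N) (fun n => c1 (N + n)%N)).
Proof.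
move=> dK lo cc hi.
have [n|N fN] := @full_tail k0 b0 b1 k1 dK.
  case/andP: (lo n) => kb bc; case/andP: (hi n) => cb bk; split=> //.
  by apply: lt_trans bc (lt_trans (cc n) cb).
exists N; apply: full_fixes_off fN => [|n].
  move=> i j z zi zj; apply/eqP; rewrite -(eqn_add2l N); apply/eqP.
  have bk n z' : ival (b0 n) (b1 n) z' -> ival (k0 n) (k1 n) z'.
    by case/andP: (lo n) => kb _; case/andP: (hi n) => _ bk; apply: ivalS; apply: ltW.
  exact: dK (bk _ _ zi) (bk _ _ zj).
by case/andP: (lo (N + n)%N) => _ ->; case/andP: (hi (N + n)%N) => ->; rewrite cc.
Qed.

End Tails.

(** * Baire category and density in stabilisers of finite sets *)

Definition dense_on (H : set oaut) (P : set oaut) := forall g, P g ->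
  forall s : seq rat, exists2 h, H h & {in s, h =1 g}.

(* Baire category: one of the countably many cosets is dense in a basic open
   set of automorphisms, and translating it gives the density of [H]. *)
Lemma somewhere_dense H : ctbl_index H ->
  exists F : seq rat, dense_on H (fun g => {in F, forall x, g x = x}).
Proof.
move=> cH; have [c cP] := ctbl_code cH.
pose lt := fun x y : rat => x < y.
pose ok := @piso rat rat setT setT lt lt.
pose ext (q : seq (rat * rat)) (g : rat -> rat) := {in q, forall a, g a.1 = a.2}.
(* If every code could be avoided by extending conditions, a generic automorphism would avoid its
   own code. *)
have [n [p [okp pP]]] : exists n p, ok p /\ forall q, ok q -> {subset p <= q} ->
    exists2 g : oaut, c g = n & ext q g.
  apply: contrapT => nP.
  pose C n (q : seq (rat * rat)) := forall g : oaut, c g = n -> ~ ext q g.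
  have dC n p : ok p -> exists q, [/\ ok q, {subset p <= q} & C n q].
    move=> okp; apply: contrapT => nq; apply: nP; exists n, p; split=> // q okq pq.
    by apply: contrapT => ng; apply: nq; exists q; split=> // g gn qg; apply: ng; exists g.
  have ok0 : ok [::] by [].
  have oT := eta_open_convex open_convexT.
  have [f [f' [[_ _ fK f'K flt] _ fC]]] := generic_iso oT oT dC ok0.
  have fK' : cancel f f' by move=> x; apply: fK.
  have f'K' : cancel f' f by move=> x; apply: f'K.
  have fm : {mono f : x y / x < y} by move=> x y; rewrite [RHS]flt.
  have [q Cq qf] := fC (c (OAut fK' f'K' fm)).
  exact: (Cq (OAut fK' f'K' fm)).
have [g0 g0n g0p] := pP p okp (fun _ => id).
exists (map fst p) => g gF s.
(* Since [g] fixes the domain of [p], all pairs in [q] lie on the graph of [g0 * g]; an element of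
   code [n] extending [q] then differs from [g0] by an element of [H] agreeing with [g] on [s]. *)
pose q := p ++ [seq (x, g0 (g x)) | x <- s].
have qg a : a \in q -> a.2 = (g0 * g) a.1.
  rewrite mem_cat => /orP[ap|/mapP[x _ ->] //].
  by rewrite oautM gF ?g0p //; apply/mapP; exists a.
have [|a ap|g1 g1n g1q] := pP q.
- move=> a /qg ag; split=> // b /qg bg.
  by rewrite ag bg /lt oaut_lt.
- by rewrite mem_cat ap.
exists (g0^-1 * g1); first by apply: cP; rewrite g0n g1n.
move=> x xs; rewrite oautM (g1q (x, g0 (g x))) ?oautK //.
by rewrite mem_cat; apply/orP; right; apply/mapP; exists x.
Qed.

Definition right_of (J : set rat) p : set rat := [set x | J x /\ p < x].
Definition left_of (J : set rat) p : set rat := [set x | J x /\ x < p].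

Lemma separated_right g J p : supp g J -> g p = p -> separated g (right_of J p).
Proof.
move=> gJ gp x y [Jx px] nR; split=> [xy|yx].
  exists y; last by rewrite xy lexx.
  by apply: gJ => Jy; apply: nR; split=> //; apply: lt_trans xy.
have [yp|py] := leP y p; first by exists p; rewrite ?yp.
by exists y; rewrite ?lexx //; apply: gJ => Jy; apply: nR.
Qed.

Lemma separated_cup (g : oaut) (a b : nat -> rat) : (forall n, g (a n) = a n /\ g (b n) = b n) ->
  separated g (cup a b).
Proof.
move=> gab x y [n /andP[ax xb]] nU; have [ga gb] := gab n.
split=> [xy|yx].
  exists (b n); rewrite // xb leNgt; apply/negP => yb; apply: nU; exists n.
  by rewrite /ival /= yb (lt_trans ax).
exists (a n); rewrite // ax andbT leNgt; apply/negP => ay; apply: nU; exists n.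
by rewrite /ival /= ay (lt_trans yx).
Qed.

Lemma split_at g J p : supp g J -> g p = p -> exists l r : oaut,
  [/\ g = l * r, supp l (left_of J p), supp r (right_of J p),
      forall x, x < p -> l x = g x & forall x, p < x -> r x = g x].
Proof.
move=> gJ gp; have [r [rg rR]] := restriction_exists (separated_right gJ gp).
have rp : r p = p by apply: rR => -[_]; rewrite ltxx.
have rgp x : p < x -> r x = g x.
  move=> px; have [Jx|nJ] := pselect (J x); first by apply: rg.
  by rewrite rR ?gJ // => -[].
have rlp x : x <= p -> r^-1 x = x.
  by move=> xp; apply: (suppV rR) => -[_]; rewrite ltNge xp.
exists (g * r^-1), r; split=> //; first by rewrite mulgVK.
- move=> x nL; rewrite oautM; case: (ltgtP x p) => [xp|px|->].
  + by rewrite rlp ?ltW // gJ // => Jx; apply: nL.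
  + by rewrite -rgp ?oautVK // -(oaut_lt r) oautVK rp.
  + by rewrite rlp.
- by move=> x xp; rewrite oautM rlp // ltW.
Qed.

(** Each term is chosen beyond the images of the previous one under [g] and its inverse, so [g]
    keeps every later term strictly between its two neighbours. *)
Lemma cofinal_sequence J g p : open_convex J -> supp g J -> J p ->
  exists z : nat -> rat, [/\ z 0%N = p, forall n, J (z n),
    forall n, [/\ z n < z n.+1, g (z n) < z n.+1 & z n < g (z n.+1)] &
    forall x, J x -> exists n, x < z n].
Proof.
move=> oJ gJ Jp; have oJ' := eta_open_convex oJ.
(* An enumeration of [J], with [p] as default value. *)
pose e n := if unpickle n is Some x then if pselect (J x) then x else p else p.
have Je n : J (e n) by rewrite /e; case: unpickle => // x; case: pselect.
have /choice[f fP] : forall nx : nat * rat, exists y, J nx.2 ->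
    [/\ J y, nx.2 < y, g nx.2 < y, g^-1 nx.2 < y & e nx.1 < y].
  move=> [n x] /=; have [Jx|] := pselect (J x); last by exists x.
  have [y|//|//|y [Jy ly _]] := eta_sat oJ' (l := [:: x; g x; g^-1 x; e n]) (r := [::]).
    rewrite !inE => /or4P[]/eqP-> //; first exact: supp_in.
    exact: supp_in (suppV gJ) Jx.
  by exists y => _; split=> //; apply: ly; rewrite !inE eqxx ?orbT.
pose z := fix z n := if n is m.+1 then f (m, z m) else p.
have Jz n : J (z n) by elim: n => //= n Jzn; case: (fP (n, z n) Jzn).
exists z; split=> // [n|x Jx].
  have [_ /= zz gz gVz _] := fP (n, z n) (Jz n); split=> //.
  by rewrite -[X in X < _](oautVK g) oaut_lt.
exists (pickle x).+1; have [_ _ _ _ /=] := fP (pickle x, z (pickle x)) (Jz _).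
by rewrite /e pickleK; case: pselect.
Qed.

Lemma locate (x : nat -> rat) m y : (exists n, y < x n) -> x m <= y ->
  (forall n, x n < x n.+1) -> exists n, [/\ (m <= n)%N, x n <= y & y < x n.+1].
Proof.
move=> ex xy xS; case: (ex_minnP ex) => -[|n] yn nmin.
  by move: (le_lt_trans (le_trans (increasing_mono xS (leq0n m)) xy) yn); rewrite ltxx.
exists n; split=> //; last by rewrite leNgt; apply/negP => /nmin; rewrite ltnn.
rewrite leqNgt; apply/negP => /(increasing_mono xS) nm.
by move: (lt_le_trans yn (le_trans nm xy)); rewrite ltxx.
Qed.

(* [g] agrees on a cofinal sequence of points with an element of [H] supported
   on small intervals around these points; their quotient fixes these points and
   is a product of three pieces, two of which are supported on alternate gaps
   and the third on a bounded interval. *)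
Lemma right_end H J p : ctbl_index H -> open_convex J -> J p ->
  (forall a b, J a -> J b -> fixes_off H (ival a b)) ->
  fixes_off H (right_of J p).
Proof.
move=> cH oJ Jp bdd g gR.
have gJ : supp g J by apply: suppS gR => x [].
have [z [z0 Jz zS zcof]] := cofinal_sequence oJ gJ Jp.
have zlt n : z n < z n.+1 by case: (zS n).
have zmono := increasing_mono zlt.
have zltn m n : (m < n)%N -> z m < z n.
  by move=> /zmono; apply: lt_le_trans.
pose x n := z (6 * n + 3)%N.
(* The intervals recur with period [d]; the bounds on [i] and [j] allow widening by two terms on
   each side without overlap. *)
have tails (d i j : nat) : (1 < i)%N -> (i < j)%N -> (j + 3 < d + i)%N ->
    exists N, fixes_off H (cup (fun n => z (d * (N + n) + i)%N) (fun n => z (d * (N + n) + j)%N)).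
  move=> i1 ij jd.
  have dK : disjoint_family (fun n => ival (z (d * n + i - 2)%N) (z (d * n + j + 2)%N)).
    have uS n : z (d * n + i - 2)%N < z (d * n.+1 + i - 2)%N by apply: zltn; lia.
    apply: disjoint_family_sub (increasing_steps uS) => n w.
    by apply: ivalS => //; apply: zmono; lia.
  apply: (tail_fixes_off cH (b0 := fun n => z (d * n + i - 1)%N)
    (b1 := fun n => z (d * n + j + 1)%N)
    (c0 := fun n => z (d * n + i)%N) (c1 := fun n => z (d * n + j)%N) dK) => n; rewrite ?zltn //; lia.
(* The first family surrounds the points [x n]. The other two are the alternate gaps, since
   [x (2 * n)] is [z (12 * n + 3)] and [x (2 * n + 1)] is [z (12 * n + 9)]. *)
have [N1 good1] := tails 6%N 2%N 4%N isT isT isT.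
have [N2 good2] := tails 12%N 3%N 9%N isT isT isT.
have [N3 good3] := tails 12%N 9%N 15%N isT isT isT.
have inR a b w : ival (z a) (z b) w -> right_of J p w.
  move=> /[dup] zw /andP[aw _]; split; first exact: (oc_conv oJ (Jz a) (Jz b)).
  by apply: le_lt_trans aw; rewrite -z0 zmono.
pose B n := ival (z (6 * (N1 + n) + 2)%N) (z (6 * (N1 + n) + 4)%N).
have dB : disjoint_family B.
  have uS n : z (6 * (N1 + n))%N < z (6 * (N1 + n.+1))%N by apply: zltn; lia.
  apply: disjoint_family_sub (increasing_steps uS) => n w.
  by apply: ivalS; apply: zmono; lia.
have /choice[v vP] : forall n, exists v : oaut,
    supp v (B n) /\ v (x (N1 + n)%N) = g (x (N1 + n)%N).
  move=> n; set m := (N1 + n)%N.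
  have cc : z (6 * m + 2)%N < z (6 * m + 4)%N by apply: zltn; lia.
  have [||v vB vx] := move1 (open_convex_ival cc) (x := x m) (x' := g (x m)); last by exists v.
    by rewrite /ival /x /=; apply/andP; split; apply: zltn; lia.
  have [_ _ lo] := zS (6 * m + 2)%N; have [_ hi _] := zS (6 * m + 3)%N.
  by move: lo hi; rewrite -!addnS /ival /x /= => -> ->.
have [h [hv hB]] := glue_exists dB (fun n => (vP n).1).
have Hh : H h by apply: good1.
have hx n : (N1 <= n)%N -> h (x n) = g (x n).
  move=> /subnKC <-; rewrite (hv (n - N1)%N); first by case: (vP (n - N1)%N).
  by rewrite /B /ival /x /=; apply/andP; split; apply: zltn; lia.
pose g1 := h^-1 * g.
have g1x n : (N1 <= n)%N -> g1 (x n) = x n by move=> /hx; rewrite /g1 oautM => <-; rewrite oautK.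
have g1R : supp g1 (right_of J p).
  by apply: suppM => //; apply/suppV; apply: suppS hB => w [n]; apply: inR.
suff Hg1 : H g1 by rewrite -[g](mulVKg h); apply: (ctblM cH).
pose M := (N1 + N2 + N3)%N.
pose Ue := cup (fun n => x (2 * (M + n))%N) (fun n => x (2 * (M + n) + 1)%N).
pose Uo := cup (fun n => x (2 * (M + n) + 1)%N) (fun n => x (2 * (M + n) + 2)%N).
have xS n : x n < x n.+1 by apply: zltn; lia.
have [|ge [gee geU]] := @restriction_exists g1 Ue.
  by apply: separated_cup => n; split; apply: g1x; lia.
have [|go [goo goU]] := @restriction_exists g1 Uo.
  by apply: separated_cup => n; split; apply: g1x; lia.
have Hge : H ge.
  apply: good2; apply: suppS geU => w [n nw]; exists (M - N2 + n)%N.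
  by apply: ivalS nw; apply: zmono; lia.
have Hgo : H go.
  apply: good3; apply: suppS goU => w [n nw]; exists (M - N3 + n)%N.
  by apply: ivalS nw; apply: zmono; lia.
have step n w : (2 * M <= n)%N -> ival (x n) (x n.+1) w ->
    if odd n then Uo w else Ue w.
  move=> Mn nw; case: ifP => n2; exists (n./2 - M)%N;
    have n2E := odd_double_half n; rewrite n2 in n2E;
    by apply: ivalS nw; apply: zmono; lia.
have eo w : Ue w -> Uo w -> False.
  move=> [n nw] [m mw]; rewrite !addn1 addn2 in nw mw.
  have := @increasing_steps x xS (2 * (M + n))%N (2 * (M + m)).+1 w nw mw; lia.
(* Beyond [x (2 * M)] the gaps and the fixed points [x n] leave nothing for [gb] to move, so its
   support is bounded. *)
pose gb := (ge * go)^-1 * g1.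
have Hgb : H gb.
  apply: (bdd p (x (2 * M)%N)) => //; first exact: Jz.
  move=> w nw; apply: (@oaut_inj (ge * go)); rewrite /gb -oautM mulVKg.
  have [Rw|nR] := pselect (right_of J p w); last first.
    have -> : g1 w = w by apply: g1R.
    by rewrite oautM goU ?geU // => -[n]; rewrite /x => /inR.
  have Mw : x (2 * M)%N <= w.
    by rewrite leNgt; apply/negP => wM; apply: nw; rewrite /ival /= wM andbT; case: Rw.
  have [|n [Mn nw' wn]] := @locate x (2 * M)%N w _ Mw xS.
    have [n wn] := zcof w Rw.1; exists n; apply: lt_le_trans wn _.
    by apply: zmono; lia.
  rewrite oautM; have [Uow|nUo] := pselect (Uo w).
    by rewrite goo // geU // => Uew; apply: eo Uew _; rewrite -goo //; apply: supp_in.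
  rewrite (goU w) //; have [Uew|nUe] := pselect (Ue w); first by rewrite gee.
  rewrite geU //; suff -> : w = x n by rewrite g1x //; lia.
  apply/eqP; rewrite eq_le nw' andbT leNgt; apply/negP => xw.
  by have := @step n w Mn; rewrite /ival /= xw wn; case: ifP => _ /(_ isT).
by rewrite -[g1](mulVKg (ge * go)); apply: (ctblM cH) => //; apply: (ctblM cH).
Qed.

(** Conjugation by negation, which turns right ends into left ends. It is kept transparent because
    its values are computed below. *)
Definition oaut_neg (g : oaut) : oaut.
Proof.
apply: (@OAut (fun x => - g (- x)%R)%R (fun x => - (g^-1)%g (- x)%R)%R) => x;
  rewrite ?opprK ?oautK ?oautVK ?opprK //.
by move=> y; rewrite ltrN2 oaut_lt ltrN2.
Defined.

Lemma left_end H J p : ctbl_index H -> open_convex J -> J p ->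
  (forall a b, J a -> J b -> fixes_off H (ival a b)) ->
  fixes_off H (left_of J p).
Proof.
move=> cH oJ Jp bdd.
have negK g : oaut_neg (oaut_neg g) = g by apply: oautP => x /=; rewrite !opprK.
have negM g h : oaut_neg (g * h) = oaut_neg g * oaut_neg h.
  by apply: oautP => x /=; rewrite !opprK.
have neg1 : oaut_neg 1 = 1 by apply: oautP => x /=; rewrite !opprK.
have negV g : oaut_neg g^-1 = (oaut_neg g)^-1.
  by apply: (mulgI (oaut_neg g)); rewrite -negM !mulgV neg1.
have negS g (B : set rat) : supp g B -> supp (oaut_neg g) (fun x => B (- x)%R).
  by move=> gB x nB; rewrite /= gB ?opprK.
pose H' g := H (oaut_neg g); pose J' x := J (- x)%R.
have cH' : ctbl_index H'.
  split; rewrite /H' ?neg1; first exact: ctbl1.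
  - by move=> g h; rewrite negM; apply: ctblM.
  - by move=> g; rewrite negV; apply: ctblV.
  have [c cP] := ctbl_code cH; exists (c \o oaut_neg) => g h /cP.
  by rewrite negM negV.
have oJ' : open_convex J'.
  split.
  - by have [x Jx] := oc_ex oJ; exists (- x)%R; rewrite /J' opprK.
  - move=> x y z Jx Jy /andP[xz zy]; apply: (oc_conv oJ Jy Jx).
    by rewrite !ltrN2 xz zy.
  - move=> x /(oc_hi oJ)[y Jy xy]; exists (- y)%R; rewrite /J' ?opprK //.
    by rewrite ltrNl.
  - move=> x /(oc_lo oJ)[y Jy xy]; exists (- y)%R; rewrite /J' ?opprK //.
    by rewrite ltrNr.
move=> g gL; rewrite -[g]negK; apply: (@right_end H' J' (- p)%R) => //.
- by rewrite /J' opprK.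
- move=> a b Ja Jb h hab; apply: (bdd (- b)%R (- a)%R) => //.
  apply: suppS (negS _ _ hab) => x /andP[ax xb].
  by rewrite /ival /= ltrNl xb ltrNr ax.
apply: suppS (negS _ _ gL) => x [Jx xp]; split=> //.
by rewrite ltrNl.
Qed.

(** A tail of intervals between [a] and [b] yields one interval from [c] to [d] handled by [H]. By
    density an element of [H] carries [c] and [d] to [a] and [b], and conjugation transfers the
    property. *)
Lemma dense_bounded H J : ctbl_index H -> open_convex J ->
  dense_on H (fun g => supp g J) ->
  forall a b, J a -> J b -> fixes_off H (ival a b).
Proof.
move=> cH oJ dJ a b Ja Jb.
have [ab|ba] := ltP a b; last first.
  move=> g gab; suff -> : g = 1 by apply: ctbl1.
  apply: oautP => x; apply: gab => /andP[ax xb].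
  by move: (lt_trans ax xb); rewrite ltNge ba.
have [e [eb eS]] := increasing_between ab.
have eJ n : J (e n) by apply: oc_conv (eb n).
have emono := increasing_mono eS.
have eltn m n : (m < n)%N -> e m < e n by move=> /emono; apply: lt_le_trans.
(* Blocks of five consecutive terms of [e] supply the nested intervals. *)
have [||||N] := @tail_fixes_off H cH (fun n => e (5 * n)%N) (fun n => e (5 * n + 1)%N)
  (fun n => e (5 * n + 2)%N) (fun n => e (5 * n + 3)%N) (fun n => e (5 * n + 4)%N)
  (fun n => e (5 * n.+1)%N).
- by apply: (@increasing_steps (fun n => e (5 * n)%N)) => n; apply: eltn; lia.
- by move=> n; apply/andP; split; apply: eltn; lia.
- by move=> n; apply: eltn; lia.
- by move=> n; apply/andP; split; apply: eltn; lia.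
set c := e (5 * N + 2)%N; set d := e (5 * N + 3)%N => tailN.
have goodcd : fixes_off H (ival c d).
  by apply: fixes_offS tailN => x cdx; exists 0%N; rewrite addn0.
have cd : c < d by apply: eltn; lia.
have [u uJ [uc ud]] := move2 oJ (eJ _) Ja (eJ _) Jb cd ab.
have [h Hh hu] := dJ u uJ [:: c; d].
have [hc hd] : h c = a /\ h d = b by rewrite !hu ?inE ?eqxx ?orbT.
move=> g gab; have : H (h^-1 * g * h^-1^-1).
  by apply: goodcd; apply: supp_conj gab => x; rewrite invgK -hc -hd => /oaut_ival.
rewrite invgK => Hg.
have -> : g = h * (h^-1 * g * h) * h^-1 by rewrite !mulgA mulgV mul1g mulgK.
by do ?apply: (ctblM cH) => //; apply: (ctblV cH).
Qed.

(** An element [m] of [H] with bounded support imitates [g] at [p]; then [m^-1 * g] fixes [p] and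
    splits into a left and a right end. *)
Lemma dense_fixes_off H J : ctbl_index H -> open_convex J ->
  dense_on H (fun g => supp g J) -> fixes_off H J.
Proof.
move=> cH oJ dJ g gJ; have bdd := dense_bounded cH oJ dJ.
have [p Jp] := oc_ex oJ; have Jgp : J (g p) by apply: supp_in.
have [m Hm [mJ mp]] : exists2 m : oaut, H m & supp m J /\ m p = g p.
  have [lo Jlo [lop logp]] : exists2 lo, J lo & lo < p /\ lo < g p.
    have [a Ja ap] := oc_lo oJ Jp; have [b Jb bgp] := oc_lo oJ Jgp.
    have [ab|ba] := leP a b; first by exists a => //; rewrite ap (le_lt_trans ab).
    by exists b => //; rewrite bgp (lt_trans ba).
  have [hi Jhi [phi gphi]] : exists2 hi, J hi & p < hi /\ g p < hi.
    have [a Ja ap] := oc_hi oJ Jp; have [b Jb bgp] := oc_hi oJ Jgp.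
    have [ab|ba] := leP a b; first by exists b => //; rewrite bgp (lt_le_trans ap).
    by exists a => //; rewrite ap (lt_trans bgp).
  have [||m mi mp] := move1 (open_convex_ival (lt_trans lop phi)) (x := p) (x' := g p).
  - by rewrite /ival /= lop.
  - by rewrite /ival /= logp.
  exists m; first exact: (bdd lo hi).
  by split=> //; apply: suppS mi => x; apply: oc_conv.
have gp : (m^-1 * g) p = p by rewrite oautM -mp oautK.
have [l [r [e lL rR _ _]]] := split_at (suppM (suppV mJ) gJ) gp.
rewrite -[g](mulVKg m) e.
apply: (ctblM cH) => //; apply: (ctblM cH); first exact: left_end lL.
exact: right_end rR.
Qed.

Lemma open_convex_left J p : open_convex J -> J p -> open_convex (left_of J p).
Proof.
move=> oJ Jp; split=> [|x y z [Jx _] [Jy yp] /[dup] xzy /andP[_ zy]|x [Jx xp]|x [Jx xp]].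
- by have [x Jx xp] := oc_lo oJ Jp; exists x.
- by split; [apply: oc_conv xzy|apply: lt_trans yp].
- by have [y Jy yx] := oc_lo oJ Jx; exists y => //; split=> //; apply: lt_trans xp.
- have [y /[dup] xyp /andP[xy yp]] := rat_dense xp; exists y => //.
  by split=> //; apply: oc_conv xyp.
Qed.

Lemma open_convex_right J p : open_convex J -> J p -> open_convex (right_of J p).
Proof.
move=> oJ Jp; split=> [|x y z [Jx px] [Jy _] /[dup] xzy /andP[xz _]|x [Jx px]|x [Jx px]].
- by have [x Jx xp] := oc_hi oJ Jp; exists x.
- by split; [apply: oc_conv xzy|apply: lt_trans xz].
- have [y /[dup] pyx /andP[py yx]] := rat_dense px; exists y => //.
  by split=> //; apply: oc_conv pyx.
- by have [y Jy xy] := oc_hi oJ Jx; exists y => //; split=> //; apply: lt_trans xy.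
Qed.

Lemma dense_on_sub H (P Q : set oaut) : (forall g, Q g -> P g) ->
  dense_on H P -> dense_on H Q.
Proof. by move=> QP dP g /QP; apply: dP. Qed.

(** Induction on [F] with [J] varying: a point of [F] in [J] cuts [g] into two factors supported on
    smaller open convex sets. *)
Lemma dense_stabiliser H (F : seq rat) J : ctbl_index H -> open_convex J ->
  dense_on H (fun g => supp g J /\ {in F, forall x, g x = x}) ->
  forall g, supp g J -> {in F, forall x, g x = x} -> H g.
Proof.
move=> cH; elim: F J => [|f F IHF] J oJ dJ g gJ gF.
  by apply: (dense_fixes_off cH oJ) gJ; apply: dense_on_sub dJ.
have gf : g f = f by apply: gF; rewrite mem_head.
have gF' : {in F, forall x, g x = x} by move=> x xF; apply: gF; rewrite inE xF orbT.
have [Jf|nJf] := pselect (J f); last first.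
  apply: (IHF J) => //; apply: dense_on_sub dJ => k [kJ kF]; split=> // x.
  by rewrite inE => /predU1P[->|/kF//]; apply: kJ.
have [l [r [e lL rR lg rg]]] := split_at gJ gf; rewrite e.
have fixl x : x \in F -> l x = x.
  move=> xF; case: (ltP x f) => [/lg->|fx]; first by rewrite gF'.
  by apply: lL => -[_]; rewrite ltNge fx.
have fixr x : x \in F -> r x = x.
  move=> xF; case: (ltP f x) => [/rg->|fx]; first by rewrite gF'.
  by apply: rR => -[_]; rewrite ltNge fx.
apply: (ctblM cH).
  apply: (IHF (left_of J f)) => //; first exact: open_convex_left.
  apply: dense_on_sub dJ => k [kL kF]; split; first by apply: suppS kL => x [].
  by move=> x; rewrite inE => /predU1P[->|/kF//]; apply: kL => -[_]; rewrite ltxx.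
apply: (IHF (right_of J f)) => //; first exact: open_convex_right.
apply: dense_on_sub dJ => k [kR kF]; split; first by apply: suppS kR => x [].
by move=> x; rewrite inE => /predU1P[->|/kF//]; apply: kR => -[_]; rewrite ltxx.
Qed.

(* Truss's small index property of the automorphism group of the rationals, for
   subgroups of countable index. *)
Theorem small_index H : ctbl_index H ->
  exists F : seq rat, forall g : oaut, {in F, forall x, g x = x} -> H g.
Proof.
move=> cH; have [F dF] := somewhere_dense cH; exists F => g gF.
apply: (dense_stabiliser (F := F) cH open_convexT) => // [|x []//].
by apply: dense_on_sub dF => k [].
Qed.

(** * The circular order and its embeddings *)

Ltac cmp_rat x y := let h := fresh in
  case: (ltgtP x y) => h /=; try (by []); try (exfalso; lra).

Section Circ.
Implicit Types x y z p : rat.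

Lemma circ_rot x y z : circ x y z = circ y z x.
Proof. by rewrite /circ; case: (x < y < z); case: (y < z < x); case: (z < x < y). Qed.

Lemma circ_irr x y : [/\ circ x x y = false, circ x y x = false & circ x y y = false].
Proof. by rewrite /circ !ltxx; split; cmp_rat x y. Qed.

Lemma circ_neq x y z : circ x y z -> [/\ x != y, y != z & x != z].
Proof.
move=> c; split; apply/eqP => e; move: c; rewrite e.
- by case: (circ_irr y z) => ->.
- by case: (circ_irr x z) => _ _ ->.
- by case: (circ_irr z y) => _ ->.
Qed.

Lemma circ_total x y z : x != y -> y != z -> x != z -> circ x y z = ~~ circ x z y.
Proof. by rewrite /circ; cmp_rat x y; cmp_rat y z; cmp_rat x z. Qed.

Lemma circ_trans p x y z : circ p x y -> circ p y z -> circ p x z.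
Proof.
by rewrite /circ; cmp_rat p x; cmp_rat x y; cmp_rat p y; cmp_rat y z; cmp_rat p z; cmp_rat x z.
Qed.

(** The circular order is recovered from the linear order [circ p] off [p], so a bijection
    preserving the latter and its base point preserves the former. *)
Lemma circ_base p x y z : p != x -> p != y -> p != z ->
  circ x y z = [|| circ p x y && circ p y z, circ p y z && circ p z x
                 | circ p z x && circ p x y].
Proof.
by rewrite /circ; cmp_rat p x; cmp_rat p y; cmp_rat p z; cmp_rat x y; cmp_rat y z; cmp_rat x z.
Qed.

(** Cut at [p], the circle becomes the points above [p] followed by those below [p]. *)
Lemma eta_circ p : eta_order [set x | p != x] (circ p).
Proof.
apply: eta_order_dense => /= [x _|x y z _ _ _|x y px py||x px|x px|x y px py].
- by case: (circ_irr p x).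
- exact: circ_trans.
- have [->|xy] := eqVneq x y; first by constructor 1.
  by rewrite circ_total //; case: (circ p y x); [constructor 3|constructor 2].
- by exists (p + 1)%R; apply/eqP => ?; lra.
- have [xp|] := ltP x p.
    exists (x - 1)%R; first by apply/eqP => ?; lra.
    have h : (x - 1 < x)%R by lra.
    by rewrite /circ h xp !orbT.
  rewrite le_eqVlt (negbTE px) /= => /rat_dense[y /[dup] pyx /andP[py yx]].
  by exists y; [rewrite lt_eqF|rewrite /circ pyx].
- have [xp|] := ltP x p.
    have [y /[dup] xyp /andP[xy yp]] := rat_dense xp.
    by exists y; [rewrite gt_eqF|rewrite /circ xyp !orbT].
  rewrite le_eqVlt (negbTE px) /= => px'.
  exists (x + 1)%R; first by apply/eqP => ?; lra.
  have h : (x < x + 1)%R by lra.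
  by rewrite /circ h px'.
- rewrite {1}/circ => /or3P[] /andP[h1 h2].
  + have [z /andP[xz zy]] := rat_dense h2; exists z.
    by rewrite lt_eqF ?(lt_trans h1) // /circ h1 xz (lt_trans h1 xz) zy.
  + have [z /andP[xz zy]] := rat_dense h1; exists z.
    by rewrite gt_eqF ?(lt_trans zy) // /circ xz zy h2 (lt_trans zy h2) !orbT.
  + exists (x + 1)%R; have h : (x < x + 1)%R by lra.
    by rewrite lt_eqF ?(lt_trans h2) // /circ h h1 h2 (lt_trans h2 h) ?orbT.
Qed.

End Circ.

(** * The embedding monoid and its units *)

Local Notation M := Emb_circ.

Definition fn (f : M) : rat -> rat := val f.

Lemma fnM (f g : M) x : fn (f * g) x = fn f (fn g x).
Proof. by []. Qed.

Lemma fn1 x : fn 1 x = x.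
Proof. by []. Qed.

Lemma fn_inj (f g : M) : fn f =1 fn g -> f = g.
Proof. by move=> /funext e; apply: val_inj. Qed.

Lemma fn_injective (f : M) : injective (fn f).
Proof. by have := valP f; rewrite inE => -[]. Qed.

Lemma fn_circ (f : M) x y z : circ x y z -> circ (fn f x) (fn f y) (fn f z).
Proof. by have := valP f; rewrite inE => -[_]; apply. Qed.

Lemma fn_circE (f : M) x y z : circ (fn f x) (fn f y) (fn f z) = circ x y z.
Proof.
apply/idP/idP => [c|]; last exact: fn_circ.
have [xy yz xz] := circ_neq c.
have ne u v : fn f u != fn f v -> u != v by apply: contra_neq => ->.
rewrite circ_total ?(ne _ _ xy) ?(ne _ _ yz) ?(ne _ _ xz) //.
by move: c; rewrite circ_total //; apply: contra; apply: fn_circ.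
Qed.

Lemma mk_emb (f : rat -> rat) : injective f ->
  (forall x y z, circ x y z -> circ (f x) (f y) (f z)) -> exists F : M, fn F = f.
Proof.
move=> fI fc; have fM : (f : Tr rat) \in submonoid_set Emb_circ by rewrite inE.
by exists (exist _ (f : Tr rat) fM).
Qed.

Definition munit (g : M) := exists2 h, g * h = 1 & h * g = 1.

Lemma munit1 : munit 1. Proof. by exists 1; rewrite mulg1. Qed.

Lemma munitM g h : munit g -> munit h -> munit (g * h).
Proof.
move=> [g' gg' g'g] [h' hh' h'h]; exists (h' * g').
  by rewrite -mulgA (mulgA h) hh' mul1g.
by rewrite -mulgA (mulgA g') g'g mul1g.
Qed.

Lemma munit_sym g h : g * h = 1 -> h * g = 1 -> munit h.
Proof. by exists g. Qed.

Lemma fnK (g h : M) : h * g = 1 -> cancel (fn g) (fn h).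
Proof. by move=> hg x; rewrite -fnM hg fn1. Qed.

Lemma mk_unit (f f' : rat -> rat) : cancel f f' -> cancel f' f ->
  (forall x y z, circ (f x) (f y) (f z) = circ x y z) ->
  exists2 g, munit g & fn g = f.
Proof.
move=> fK f'K fc; have fI := can_inj fK; have f'I := can_inj f'K.
have [g gf] := mk_emb fI (fun x y z => etrans (fc x y z)).
have [x y z|h hf] := mk_emb f'I; first by rewrite -[circ (f' x) _ _]fc !f'K.
by exists g => //; exists h; apply: fn_inj => x; rewrite fnM gf hf ?fK ?f'K.
Qed.

Lemma unit_of_iso p p' f f' :
  iso_between [set x | p != x] [set x | p' != x] (circ p) (circ p') f f' ->
  exists g, [/\ munit g, fn g p = p' & forall x, p != x -> fn g x = f x].
Proof.
move=> [fD f'D fK f'K flt].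
pose F (p p' : rat) (f : rat -> rat) x : rat := if p == x then p' else f x.
have FK (r r' : rat) (k k' : rat -> rat) : (forall x, r != x -> r' != k x) -> (forall x, r != x -> k' (k x) = x) ->
    cancel (F r r' k) (F r' r k').
  move=> kD kK x; rewrite /F; have [->|rx] := eqVneq r x; first by rewrite eqxx.
  by rewrite (negbTE (kD _ rx)) kK.
have Fp : F p p' f p = p' by rewrite /F eqxx.
have FN x : p != x -> F p p' f x = f x by rewrite /F => /negbTE->.
have base x y : circ p' (F p p' f x) (F p p' f y) = circ p x y.
  have [<-|px] := eqVneq p x.
    by rewrite Fp; have [-> _ _] := circ_irr p y; case: (circ_irr p' (F p p' f y)).
  have [<-|py] := eqVneq p y.
    by rewrite Fp; have [_ -> _] := circ_irr p x; case: (circ_irr p' (F p p' f x)).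
  by rewrite !FN // flt.
have Fc x y z : circ (F p p' f x) (F p p' f y) (F p p' f z) = circ x y z.
  have [<-|px] := eqVneq p x; first by rewrite {1}Fp base.
  have [<-|py] := eqVneq p y; first by rewrite Fp !(circ_rot _ p) !(circ_rot _ p') base.
  have [<-|pz] := eqVneq p z; first by rewrite Fp -!(circ_rot p) -!(circ_rot p') base.
  have FD w : p != w -> p' != F p p' f w by move=> pw; rewrite FN //; apply: fD.
  by rewrite (circ_base px py pz) (circ_base (FD _ px) (FD _ py) (FD _ pz)) !base.
have [g gu gF] := mk_unit (FK p p' f f' fD fK) (FK p' p f' f f'D f'K) Fc.
by exists g; split; rewrite ?gF.
Qed.

Lemma circ_extend p p' (q : seq (rat * rat)) :
  piso [set x | p != x] [set x | p' != x] (circ p) (circ p') q ->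
  exists g, [/\ munit g, fn g p = p' & {in q, forall a, fn g a.1 = a.2}].
Proof.
move=> okq.
have [f [f' [ff' fq]]] := extend_iso (eta_circ p) (eta_circ p') okq.
have [g [gu gp gf]] := unit_of_iso ff'; exists g; split=> // a aq.
by rewrite gf ?fq //; case: (okq _ aq).
Qed.

(* Cutting the circle at [p] identifies the stabiliser of [p] with [oaut]. *)
Lemma cut p : exists phi phi' : rat -> rat, iso_between setT [set x | p != x]
  (fun x y : rat => x < y) (circ p) phi phi'.
Proof.
have ok0 : piso setT [set x | p != x] (fun x y : rat => x < y) (circ p) [::] by [].
have [f [f' [ff' _]]] := extend_iso (eta_open_convex open_convexT) (eta_circ p) ok0.
by exists f, f'.
Qed.

Lemma cut_lift p phi phi' (g : oaut) :
  iso_between setT [set x | p != x] (fun x y : rat => x < y) (circ p) phi phi' ->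
  exists m, [/\ munit m, fn m p = p & forall x, fn m (phi x) = phi (g x)].
Proof.
move=> [phiD _ phiK phi'K phi_lt].
have [|m [mu mp mf]] := @unit_of_iso p p (phi \o g \o phi') (phi \o (g^-1)%g \o phi').
  split=> [x _|y _|x px|y py|x x' px px'] /=.
  - exact: phiD.
  - exact: phiD.
  - by rewrite phiK // oaut_funK phi'K.
  - by rewrite phiK // oaut_invK phi'K.
  - by rewrite -phi_lt // oaut_lt phi_lt // !phi'K.
by exists m; split=> // x; rewrite mf /= ?phiK //; apply: phiD.
Qed.

Lemma cut_unit p phi phi' (m : M) : munit m -> fn m p = p ->
  iso_between setT [set x | p != x] (fun x y : rat => x < y) (circ p) phi phi' ->
  exists g : oaut, forall x, fn m (phi x) = phi (g x).
Proof.
move=> [m' mm' m'm] mp [phiD _ phiK phi'K phi_lt].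
have m'p : fn m' p = p by rewrite -[p in LHS]mp (fnK m'm).
have ne (k : M) x : fn k p = p -> p != fn k (phi x).
  by move=> kp; rewrite -[X in X != _]kp; apply: contra_neq (phiD x I) => /fn_injective.
pose g k x := phi' (fn k (phi x)).
have gE (k : M) x : fn k p = p -> phi (g k x) = fn k (phi x).
  by move=> kp; rewrite phi'K //; apply: ne.
have gK (k l : M) : fn k p = p -> fn l p = p -> l * k = 1 -> cancel (g k) (g l).
  by move=> kp lp lk x; rewrite {1}/g gE // (fnK lk) phiK.
have gm : {mono g m : x y / x < y}.
  by move=> x y; rewrite phi_lt // !gE // -[X in circ X]mp fn_circE -phi_lt.
exists (OAut (gK _ _ mp m'p m'm) (gK _ _ m'p mp mm') gm) => x /=.
by rewrite gE.
Qed.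

(** Density of the units. The first point of [s] serves as base point (0 if [s] is empty), and [f]
    on the remaining points is a finite partial isomorphism of the cut circles. *)
Lemma unit_approx (f : M) (s : seq rat) :
  exists2 g, munit g & {in s, fn g =1 fn f}.
Proof.
pose p := head 0%R s.
have [|g [gu gp gs]] := @circ_extend p (fn f p) [seq (x, fn f x) | x <- s & p != x].
  move=> a /mapP[x]; rewrite mem_filter => /andP[px xs] -> /=; split=> //.
    by apply: contra_neq px => /fn_injective.
  by move=> b /mapP[y _ ->] /=; rewrite fn_circE.
exists g => // x xs; have [<-//|px] := eqVneq p x.
by apply: (gs (x, fn f x)); apply/mapP; exists x; rewrite // mem_filter px.
Qed.

Lemma oaut_circ (g : oaut) : exists2 h, munit h & fn h = g.
Proof.
apply: (mk_unit (oautK g) (oautVK g)) => x y z.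
by rewrite /circ !oaut_lt.
Qed.

(** * Sparse embeddings *)

Definition lexlt (a b : rat * rat) := (a.1 < b.1) || (a.1 == b.1) && (a.2 < b.2).

Lemma eta_lexlt : eta_order setT lexlt.
Proof.
apply: eta_order_dense => [[x s] _|[x s] [y t] [z r] _ _ _|[x s] [y t] _ _||[x s] _|[x s] _|[x s] [y t] _ _];
  rewrite /lexlt /=.
- by rewrite !ltxx andbF.
- move=> /orP[xy|/andP[/eqP-> st]] /orP[yz|/andP[/eqP<- tr]].
  + by rewrite (lt_trans xy yz).
  + by rewrite xy.
  + by rewrite yz.
  + by rewrite eqxx (lt_trans st tr) orbT.
- case: (ltgtP x y) => [_|_|->]; [by constructor 2|by constructor 3|].
  by case: (ltgtP s t) => [_|_|->]; [constructor 2|constructor 3|constructor 1].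
- by exists (0%R, 0%R).
- by exists (x, s - 1)%R => //=; rewrite eqxx ltrBlDr ltrDl ltr01 orbT.
- by exists (x, s + 1)%R => //=; rewrite eqxx ltrDl ltr01 orbT.
- move=> /orP[/rat_dense[z /andP[xz zy]]|/andP[/eqP<- /rat_dense[r /andP[sr rt]]]].
    by exists (z, 0%R) => /=; rewrite xz zy.
  by exists (x, r) => /=; rewrite eqxx sr rt !orbT.
Qed.

Definition circ_lex a b c :=
  [|| lexlt a b && lexlt b c, lexlt b c && lexlt c a | lexlt c a && lexlt a b].

(** The right-hand side uses the first coordinates only through equality and [circ], so units may
    act on them. *)
Lemma circ_lexE a b c : circ_lex a b c =
  if a.1 == b.1 then if b.1 == c.1 then circ a.2 b.2 c.2 else a.2 < b.2
  else if b.1 == c.1 then b.2 < c.2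
  else if a.1 == c.1 then c.2 < a.2 else circ a.1 b.1 c.1.
Proof.
case: a b c => [x s] [y t] [z r]; rewrite /circ_lex /lexlt /circ /=.
by cmp_rat x y; cmp_rat y z; cmp_rat x z;
  case: (s < t); case: (t < r); case: (r < s).
Qed.

(* Every point is replaced by a copy of the rationals, of which the image keeps
   only the origin. *)
Lemma sparse_embedding : exists u : M,
  [/\ forall g, munit g -> exists2 g', munit g' & g' * u = u * g,
      forall f y, (forall x, fn (u * f) x <> y) ->
        exists g, [/\ munit g, g * (u * f) = u * f & fn g y <> y] &
      exists y, forall x, fn u x <> y].
Proof.
have ok0 : piso setT setT lexlt (fun x y : rat => x < y) [::] by [].
have [rho [rho' [[_ _ rhoK rho'K rho_lt] _]]] :=
  extend_iso eta_lexlt (eta_open_convex open_convexT) ok0.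
have rho_inj a b : rho a = rho b -> a = b by move=> /(congr1 rho'); rewrite !rhoK.
have circ_rho a b c : circ (rho a) (rho b) (rho c) = circ_lex a b c.
  by rewrite /circ /circ_lex -!rho_lt.
have [|x y z|u uE] := @mk_emb (fun q => rho (q, 0%R)).
- by move=> x y /rho_inj[].
- move=> c; rewrite circ_rho circ_lexE /=; have [xy yz xz] := circ_neq c.
  by rewrite (negbTE xy) (negbTE yz) (negbTE xz).
exists u; split.
- move=> g [g' gg' g'g].
  (* The lift of [g] permutes the copies of the rationals as [g] permutes points. *)
  pose F (k : M) y := rho (fn k (rho' y).1, (rho' y).2).
  have FK (k l : M) : l * k = 1 -> cancel (F k) (F l).
    by move=> lk y; rewrite /F rhoK //= (fnK lk) -surjective_pairing rho'K.
  have Fc x y z : circ (F g x) (F g y) (F g z) = circ x y z.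
    rewrite -[x in RHS]rho'K // -[y in RHS]rho'K // -[z in RHS]rho'K //.
    by rewrite !circ_rho !circ_lexE /= !(inj_eq (@fn_injective g)) fn_circE.
  have [h hu hF] := mk_unit (FK _ _ g'g) (FK _ _ gg') Fc; exists h => //.
  by apply: fn_inj => x; rewrite !fnM hF uE /F rhoK.
- move=> f y yf; pose r := (rho' y).1; pose s := (rho' y).2.
  have yE : y = rho (r, s) by rewrite -surjective_pairing rho'K.
  (* The radius keeps the origin of the copy out of the interval around [y], unless [y] is itself
     that origin, which is then missed by [u * f]. *)
  pose d : rat := if s == 0%R then 1%R else `|s|%R.
  have d0 : 0%R < d.
    by rewrite /d; case: eqVneq => // s0; rewrite normr_gt0.
  pose a := rho (r, s - d)%R; pose b := rho (r, s + d)%R.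
  have yab : ival a b y.
    rewrite /ival /= yE -!rho_lt // /lexlt /= eqxx !ltxx /=.
    by rewrite ltrBlDr !ltrDl d0.
  have off x : ~ ival a b (fn (u * f) x).
    rewrite fnM uE /ival /= -!rho_lt // /lexlt /= => /andP[h1 h2].
    have e : fn f x = r.
      by move: h1 h2; case: (ltgtP r (fn f x)).
    move: h1 h2; rewrite e eqxx !ltxx /= /d; case: eqVneq => [s0|s0] h1 h2.
      by apply: (yf x); rewrite fnM uE e yE s0.
    have [sp|sn] := ltP 0%R s; first by move: h1; rewrite gtr0_norm // subrr ltxx.
    by move: h2; rewrite ler0_norm // subrr ltxx.
  have [y' /andP[yy' y'b]] : exists y', y < y' < b by apply: rat_dense; case/andP: yab.
  have ab : a < b by case/andP: yab => ay yb; apply: lt_trans yb.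
  have [||k kab ky] := move1 (open_convex_ival ab) (x := y) (x' := y') => //.
    by case/andP: yab => ay _; rewrite /ival /= y'b (lt_trans ay).
  have [g gu gk] := oaut_circ k; exists g; split=> //.
    by apply: fn_inj => x; rewrite fnM gk kab //; apply: off.
  by rewrite gk ky => e; rewrite e ltxx in yy'.
- by exists (rho (0%R, 1%R)) => x; rewrite uE => /rho_inj[].
Qed.

(** * Rigidity of endomorphisms fixing the units *)

Lemma fn_factor (h k : M) : (forall x, exists x', fn k x = fn h x') ->
  exists j, k = h * j.
Proof.
move=> /choice[j jP].
have [x y e|x y z|J JE] := @mk_emb j.
- by apply: (@fn_injective k); rewrite !jP e.
- by rewrite -[circ x y z](fn_circE k) !jP fn_circE.
- by exists J; apply: fn_inj => x; rewrite fnM JE.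
Qed.

Lemma fn_cancel (f g h : M) : f * g = f * h -> g = h.
Proof.
move=> e; apply: fn_inj => x; apply: (@fn_injective f).
by rewrite -!fnM e.
Qed.

Lemma move_circ p p' x x' : p != x -> p' != x' ->
  exists g, [/\ munit g, fn g p = p' & fn g x = x'].
Proof.
move=> px px'; have [|g [gu gp gx]] := @circ_extend p p' [:: (x, x')].
  move=> a; rewrite inE => /eqP->; split=> // b; rewrite inE => /eqP-> /=.
  by have [_ _ ->] := circ_irr p x; have [_ _ ->] := circ_irr p' x'.
by exists g; split=> //; apply: (gx (x, x')); rewrite mem_head.
Qed.

Lemma fresh (s : seq rat) : exists x, x \notin s.
Proof.
have [//|//|//|x [_ sx _]] := eta_sat (eta_open_convex open_convexT) (l := s) (r := [::]).
by exists x; apply/negP => /sx; rewrite ltxx.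
Qed.

Lemma commute_units (k : M) : (forall g, munit g -> k * g = g * k) -> k = 1.
Proof.
move=> kc; apply: fn_inj => q; rewrite fn1; apply/eqP; rewrite eq_sym; apply/negPn/negP => qk.
have [r] := fresh [:: q; fn k q]; rewrite !inE negb_or => /andP[rq rk].
have [|g [gu gq gk]] := @move_circ q q (fn k q) r qk; first by rewrite eq_sym.
by case/negP: rk; rewrite -gk -fnM -kc // fnM gq.
Qed.

(* [psi f] has its image in that of [f], because [psi] preserves the relation
   [g * f = f]; sparse embeddings make this rigid. *)
Lemma endo_fixing_units (psi : M -> M) :
  (forall f g, psi (f * g) = psi f * psi g) -> (forall g, munit g -> psi g = g) ->
  forall f, psi f = f.
Proof.
move=> psiM psiU; have [u [lift mv [b bu]]] := sparse_embedding.
have factor f : exists j, psi (u * f) = u * f * j.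
  apply: fn_factor => x; apply: contrapT => nx.
  have [x' e|g [gu guf gy]] := mv f (fn (psi (u * f)) x); first by apply: nx; exists x'.
  by apply: gy; rewrite -fnM -[g]psiU // -psiM guf.
have psiu : psi u = u.
  (* Here [psi u = u * k]. Each unit [g] has a lift [g'] with [g' * u = u * g], which makes [k]
     commute with [g]. *)
  have [k] := factor 1; rewrite mulg1 => uk.
  suff k1 : k = 1 by rewrite uk k1 mulg1.
  apply: commute_units => g gu; have [g' g'u e] := lift g gu.
  apply: (@fn_cancel u); rewrite !mulgA -uk -e -mulgA -uk -[g']psiU // -psiM e psiM.
  by rewrite (psiU g).
have psiE f : exists j, psi f = f * j.
  have [j e] := factor f; exists j; apply: (@fn_cancel u).
  by rewrite mulgA -e psiM psiu.
move=> f; have [j e] := psiE f; suff j1 : j = 1 by rewrite e j1 mulg1.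
apply: fn_inj => p; rewrite fn1; apply/eqP; rewrite eq_sym; apply/negPn/negP => pj.
(* [g] carries [fn u 0] to [p], and the point [b] missed by [u] to [fn j p]. Evaluation at 0 will
   put [b] into the image of [u]. *)
have [|g [gu ga gb]] := @move_circ (fn u 0%R) p b (fn j p) _ pj.
  by apply/eqP; apply: bu.
have [j' e'] := psiE (f * (g * u)).
have {}e' : j * (g * u) = g * u * j'.
  apply: (@fn_cancel f); rewrite !mulgA -e.
  by move: e'; rewrite !psiM psiu (psiU g) // !mulgA.
have := congr1 (fun h => fn h 0%R) e'.
by rewrite !fnM ga -gb => /fn_injective/esym/bu.
Qed.

(** * Faithful closed actions of the embedding monoid on countable sets *)

Section Action.
Variables (Omega : countType) (act : M -> Omega -> Omega).
Hypothesis act1 : forall a, act 1 a = a.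
Hypothesis actM : forall f g a, act (f * g) a = act f (act g a).
Hypothesis act_faithful : forall f g, act f =1 act g -> f = g.
Hypothesis act_closed : forall T : Omega -> Omega,
  (forall s : seq Omega, exists f, {in s, act f =1 T}) -> exists f, act f =1 T.

Definition supports a (F : seq rat) :=
  forall g, munit g -> {in F, forall x, fn g x = x} -> act g a = a.

Lemma act_mulV g a b : munit g -> act g a = act g b -> a = b.
Proof.
by move=> [h _ hg] e; rewrite -[a]act1 -[b]act1 -hg !actM e.
Qed.

(** Cutting at 0 lets [oaut] act on [Omega]. The orbit of [a] is countable, so its stabiliser has
    countable index and [small_index] applies. *)
Lemma finite_support a : exists F, supports a F.
Proof.
have [phi [phi' ff']] := cut 0%R.
have /choice[io ioP] := fun g => cut_lift g ff'.
have io_uniq m (g : oaut) : fn m 0%R = 0%R -> (forall x, fn m (phi x) = phi (g x)) -> m = io g.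
  move=> m0 mg; have [_ i0 ig] := ioP g; apply: fn_inj => y.
  have [<-|y0] := eqVneq 0%R y; first by rewrite m0 i0.
  by rewrite -(isoVK ff' y0) mg ig.
have ioM g h : io (g * h) = io g * io h.
  apply/esym/io_uniq => [|x]; have [_ g0 gP] := ioP g; have [_ h0 hP] := ioP h.
    by rewrite fnM h0 g0.
  by rewrite fnM hP gP.
have io1 : io 1 = 1 by apply/esym/io_uniq.
pose H g := act (io g) a = a.
have cH : ctbl_index H.
  split; rewrite /H ?io1 //.
  - by move=> g h Hg Hh; rewrite ioM actM Hh.
  - move=> g Hg; rewrite -{1}Hg -actM -ioM mulVg io1 act1 //.
  exists (fun g => pickle (act (io g) a)) => g h /(pcan_inj pickleK) gh.
  by rewrite ioM actM -gh -actM -ioM mulVg io1.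
have [F FH] := small_index cH; exists (0%R :: map phi F) => m mu mF.
have m0 : fn m 0%R = 0%R by apply: mF; rewrite mem_head.
have [g mg] := cut_unit mu m0 ff'; rewrite (io_uniq m g m0 mg).
apply: FH => x xF; have phi_inj : injective phi.
  by apply: can_inj => y; apply: (isoK ff').
by apply: phi_inj; rewrite -mg mF // inE map_f ?orbT.
Qed.

(** At [a] the value is that of any unit agreeing with [f] on a finite support of [a]; closedness
    makes this pointwise limit the action of an element. *)
Lemma closed_extension : exists psi : M -> M, forall f a, exists F : seq rat, forall g,
  munit g -> {in F, fn g =1 fn f} -> act (psi f) a = act g a.
Proof.
have /choice[F FP] := finite_support.
have same a g h : munit g -> munit h -> {in F a, fn g =1 fn h} -> act g a = act h a.
  move=> [g' gg' g'g] hu gh; rewrite -[h]mul1g -gg' -mulgA actM [act (g' * h) a]FP //.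
    by apply: munitM hu; apply: (munit_sym gg' g'g).
  by move=> x xF; rewrite fnM -gh // (fnK g'g).
suff psiP f : exists k, forall a g, munit g -> {in F a, fn g =1 fn f} -> act k a = act g a.
  have /choice[psi psi'] := psiP; exists psi => f a; exists (F a) => g; exact: psi'.
have /choice[G GP] : forall a, exists g, munit g /\ {in F a, fn g =1 fn f}.
  by move=> a; have [g gu gf] := unit_approx f (F a); exists g.
have [s|k kE] := act_closed (T := fun a => act (G a) a).
  have [g gu gf] := unit_approx f (flatten [seq F a | a <- s]); exists g => a xs.
  have [Gu Gf] := GP a; apply: same => // x xF; rewrite Gf // gf //.
  by apply/flattenP; exists (F a) => //; apply: map_f.
exists k => a g gu gf; rewrite kE; have [Gu Gf] := GP a; apply: same => // x xF.
by rewrite Gf // gf.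
Qed.

(** The extension [psi] is multiplicative, by approximation with units, and fixes the units, so it
    is the identity and inherits the approximation property. *)
Lemma act_continuous f a : exists F : seq rat, forall f',
  {in F, fn f' =1 fn f} -> act f' a = act f a.
Proof.
have [psi psiP] := closed_extension.
have psiU g : munit g -> psi g = g.
  move=> gu; apply: act_faithful => b; have [F FP] := psiP g b; exact: FP.
have psiM h k : psi (h * k) = psi h * psi k.
  apply: act_faithful => b; rewrite actM.
  have [Fk FkP] := psiP k b; have [Fhk FhkP] := psiP (h * k) b.
  have [gk gku gkE] := unit_approx k (Fk ++ Fhk).
  have {FkP} -> : act (psi k) b = act gk b.
    by apply: FkP => // x xF; apply: gkE; rewrite mem_cat xF.
  have [Fh FhP] := psiP h (act gk b).
  have [gh ghu ghE] := unit_approx h (Fh ++ map (fn k) Fhk).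
  have -> : act (psi h) (act gk b) = act gh (act gk b).
    by apply: FhP => // x xF; apply: ghE; rewrite mem_cat xF.
  rewrite -actM; apply: FhkP; first exact: munitM.
  move=> x xF; rewrite !fnM gkE ?mem_cat ?xF ?orbT // ghE // mem_cat map_f ?orbT //.
have psiE := endo_fixing_units psiM psiU.
have [F FP] := psiP f a; exists F => f' ff'.
have [F' F'P] := psiP f' a; have [g gu gf] := unit_approx f' (F ++ F').
rewrite -(psiE f) -(psiE f') (F'P g) // => [|x xF]; last by rewrite gf // mem_cat xF orbT.
by rewrite (FP g) // => x xF; rewrite gf ?ff' // mem_cat xF.
Qed.

(** * Least supports and point stabilisers *)

(** If [g] moves [x] to [y] and fixes the rest of [F], then [x] is moved to some nearby [y'] fixing
    [F'], and [y] is moved to [y'] fixing [F]. Both moves fix [a], and together with [g] they give a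
    unit fixing [F]. *)
Lemma supports_remove a x F F' : supports a F -> supports a F' ->
  x \notin F' -> supports a [seq y <- F | x != y].
Proof.
move=> aF aF' xF'; set G := [seq z <- F | x != z] => g gu gG; set y := fn g x.
have xG z : z \in G -> x != z by rewrite mem_filter => /andP[].
have fixF h : munit h -> fn h x = x -> {in G, forall z, fn h z = z} -> act h a = a.
  move=> hu hx hG; apply: aF => // z zF; have [<-//|xz] := eqVneq x z.
  by apply: hG; rewrite mem_filter xz.
have [yx|xy] := eqVneq x y; first by apply: fixF.
have yG z : z \in G -> y != z.
  by move=> zG; rewrite -(gG z zG) (inj_eq (@fn_injective g)) xG.
pose Z := F' ++ G.
have oT := eta_open_convex open_convexT.
have [|||lo [_ loZ lox]] := eta_sat oT (l := [seq z <- Z | z < x]) (r := [:: x]) => //.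
  by move=> z w; rewrite mem_filter inE => /andP[zx _] /eqP->.
have [|||hi [_ hix hiZ]] := eta_sat oT (l := [:: x]) (r := [seq z <- Z | x < z]) => //.
  by move=> z w; rewrite mem_filter inE => /eqP-> /andP[].
have {}lox : lo < x by apply: lox; rewrite inE.
have {}hix : x < hi by apply: hix; rewrite inE.
have offZ z : z \in Z -> ~ ival lo hi z.
  move=> zZ /andP[loz zhi]; have := zZ; rewrite mem_cat; case: (ltgtP z x) => [zx|xz|->].
  - by have := loZ z; rewrite mem_filter zx zZ => /(_ isT); rewrite ltNge (ltW loz).
  - by have := hiZ z; rewrite mem_filter xz zZ => /(_ isT); rewrite ltNge (ltW zhi).
  - by rewrite (negbTE xF') mem_filter eqxx.
(* It suffices to move [y] next to [x] by an automorphism fixing [F]. *)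
have near y' : ival lo hi y' -> x != y' ->
    {in G, forall z, circ x y z = circ x y' z /\ circ x z y = circ x z y'} -> act g a = a.
  move=> y'J xy' yy'.
  have [||k kJ ky'] := move1 (open_convex_ival (lt_trans lox hix)) (x := x) (x' := y') => //.
    by rewrite /ival /= lox.
  have [k' k'u k'E] := oaut_circ k.
  have k'Z z : z \in Z -> fn k' z = z by move=> zZ; rewrite k'E; apply/kJ/offZ.
  have ka : act k' a = a by apply: aF' => // z zF; apply: k'Z; rewrite mem_cat zF.
  have [|m [mu mx mE]] := @circ_extend x x ((y, y') :: [seq (z, z) | z <- G]).
    move=> b; rewrite inE => /predU1P[->|/mapP[z zG ->]]; split=> //=; do ?exact: xG.
      move=> c; rewrite inE => /predU1P[->|/mapP[w wG ->]] /=.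
        by case: (circ_irr x y) => _ _ ->; case: (circ_irr x y') => _ _ ->.
      by case: (yy' _ wG).
    move=> c; rewrite inE => /predU1P[->|/mapP[w wG ->]] //=.
    by case: (yy' _ zG).
  have mG z : z \in G -> fn m z = z.
    by move=> zG; apply: (mE (z, z)); rewrite inE map_f ?orbT.
  have my : fn m y = y' by apply: (mE (y, y')); rewrite mem_head.
  have ma : act m a = a by apply: fixF.
  have [k1 kk1 k1k] := k'u.
  apply: (act_mulV mu); apply: (act_mulV (munit_sym kk1 k1k)).
  have k1a : act k1 a = a by rewrite -{1}ka -actM k1k act1.
  rewrite ma k1a -!actM.
  apply: fixF => [||z zG].
  - by do ?apply: munitM => //; apply: munit_sym kk1 k1k.
  - by rewrite !fnM -/y my -ky' -k'E (fnK k1k).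
  - by rewrite !fnM gG // mG // -[z in LHS]k'Z ?(fnK k1k) // mem_cat zG orbT.
have Dx := eta_circ x.
have gcirc z w : z \in G -> w \in G -> circ x z w = circ y z w.
  by move=> zG wG; rewrite -[LHS](fn_circE g) (gG z) // (gG w).
(* By [gcirc], [x] and [y] lie in the same gap of [G], so seen from [x] the point [y] comes before
   all of [G] or after it. Accordingly [y'] is taken just after or just before [x]. *)
have [side|nside] := pselect (forall z, z \in G -> circ x y z).
  have [//|z|//|y' [/= xy' _ y'r]] := eta_sat Dx (l := [::]) (r := [:: y; hi]).
    by rewrite !inE => /orP[]/eqP-> //=; rewrite lt_eqF.
  have y'y : circ x y' y by apply: y'r; rewrite mem_head.
  have y'hi : circ x y' hi by apply: y'r; rewrite !inE eqxx orbT.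
  apply: (near y') => //.
    by move: y'hi; rewrite /circ => /or3P[]/andP[h1' h2']; apply/andP; split; lra.
  move=> z zG; have h1 := side z zG; have h2 := circ_trans y'y h1.
  rewrite h1 h2; split=> //.
  by rewrite !(eta_asym Dx _ _ h1) ?(eta_asym Dx _ _ h2) //=; apply: xG.
have side z : z \in G -> circ x z y.
  move=> zG; have zy : z != y by rewrite eq_sym yG.
  rewrite (circ_total (xG _ zG) zy xy); apply/negP => yz.
  apply: nside => w wG; rewrite (circ_total xy (yG _ wG) (xG _ wG)); apply/negP => wy.
  have h1 := circ_trans wy yz.
  move: (gcirc _ _ wG zG); rewrite h1 => /esym.
  have yzw : circ y z w by rewrite (circ_base xy (xG _ zG) (xG _ wG)) wy yz !orbT.
  by rewrite (eta_asym (eta_circ y) _ _ yzw) //=; apply: yG.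
have [v|//|//|y' [/= xy' y'l _]] := eta_sat Dx (l := [:: y; lo]) (r := [::]).
  by rewrite !inE => /orP[]/eqP-> //=; rewrite gt_eqF.
have yy' : circ x y y' by apply: y'l; rewrite mem_head.
have loy' : circ x lo y' by apply: y'l; rewrite !inE eqxx orbT.
apply: (near y') => //.
  by move: loy'; rewrite /circ => /or3P[]/andP[h1' h2']; apply/andP; split; lra.
move=> z zG; have h1 := side z zG; have h2 := circ_trans h1 yy'.
rewrite h1 h2; split=> //.
by rewrite !(eta_asym Dx _ _ h1) ?(eta_asym Dx _ _ h2) //=; apply: xG.
Qed.

(** By faithfulness some point is moved, so its supports are nonempty. A shortest support lies in
    all others, since [supports_remove] would shorten it. *)
Lemma minimal_support : exists a F, [/\ supports a F, F != [::] &
  forall F', supports a F' -> {subset F <= F'}].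
Proof.
have [g0 [g0u g00 _]] : exists g, [/\ munit g, fn g 0%R = 1%R & fn g 1%R = 0%R].
  exact: move_circ.
have [a g0a] : exists a, act g0 a <> a.
  apply: contrapT => na; suff g01 : g0 = 1 by move: g00; rewrite g01 fn1.
  by apply: act_faithful => a; rewrite act1; apply: contrapT => ga; apply: na; exists a.
pose P n := `[< exists2 F, supports a F & size F = n >].
have exP : exists n, P n.
  have [F aF] := finite_support a.
  by exists (size F); apply/asboolP; exists F.
case: (ex_minnP exP) => n /asboolP[F aF <-] minF.
exists a, F; split=> //.
  by apply/eqP => F0; apply: g0a; apply: aF => //; rewrite F0.
move=> F' aF' x xF; apply/negPn/negP => xF'.
have : (size F <= size [seq y <- F | x != y])%N.
  apply: minF; apply/asboolP; exists [seq y <- F | x != y] => //.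
  exact: supports_remove aF aF' xF'.
rewrite size_filter leqNgt => /negP; apply.
rewrite -(count_predC (fun y => x != y) F) -[X in (X < _)%N]addn0 ltn_add2l -has_count.
by apply/hasP; exists x; rewrite //= eqxx.
Qed.

Lemma supports_move a F g : munit g -> supports a F -> supports (act g a) (map (fn g) F).
Proof.
move=> [g' gg' g'g] aF h hu hF; rewrite -actM -[h * g]mul1g -gg' -mulgA actM; congr act.
apply: aF => [|x xF].
  by do ?apply: munitM => //; [apply: munit_sym gg' g'g|exists g'].
by rewrite !fnM hF ?(fnK g'g) // map_f.
Qed.

(* Two translates of a minimal support with [q] as their only common point. *)
Lemma point_stabiliser q : exists s : seq Omega, forall g, munit g ->
  {in s, forall a, act g a = a} -> fn g q = q.
Proof.
have [a [F [aF F0 minF]]] := minimal_support.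
have [x xF] : exists x, x \in F by case: F F0 {aF minF} => // x F _; exists x; rewrite mem_head.
have [r [ru rx _]] : exists r, [/\ munit r, fn r x = q & fn r (x + 1)%R = (q + 1)%R].
  by apply: move_circ; apply/eqP => ?; lra.
pose E := map (fn r) F.
(* By leastness, an element fixing a translate of [a] maps the translated support onto itself. *)
have onE t g : munit t -> munit g -> act g (act t (act r a)) = act t (act r a) ->
    forall y, y \in map (fn t) E -> exists2 z, z \in map (fn t) E & fn g z = y.
  move=> tu gu ga y yE; have tru := munitM tu ru; have [k trk ktr] := tru.
  have gtr : supports a (map (fn (k * g * (t * r))) F).
    have e : act (k * g * (t * r)) a = a by rewrite !actM ga -(actM t) -actM ktr act1.
    rewrite -{1}e; apply: supports_move => //.
    by do ?apply: munitM => //; apply: munit_sym trk ktr.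
  have [z zF yz] : exists2 z, z \in F & y = fn (t * r) z.
    by case/mapP: yE => w /mapP[z zF ->] ->; exists z.
  have /mapP[w wF zw] := minF _ gtr z zF.
  exists (fn (t * r) w); first by rewrite fnM; do 2!apply: map_f.
  by rewrite yz zw -[RHS]fnM (mulgA (t * r)) (mulgA (t * r) k) trk mul1g.
have [phi [phi' ff']] := cut q.
(* In the coordinate of the circle cut at [q], a translation by [c], which is no difference of
   points of [E], moves [E] off itself except at [q]. *)
have [c cE] := fresh [seq (y - z)%R | y <- map phi' E, z <- map phi' E].
have [tau tauE] : exists tau : oaut, forall y, tau y = (y + c)%R.
  have p1 : cancel (fun y => y + c)%R (fun y => y - c)%R by move=> y; rewrite addrK.
  have p2 : cancel (fun y => y - c)%R (fun y => y + c)%R by move=> y; rewrite subrK.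
  by exists (OAut p1 p2 (fun x y => ltrD2r c x y)).
have [t [tu tq tphi]] := cut_lift tau ff'.
have meet y : y \in E -> y \in map (fn t) E -> y = q.
  move=> yE /mapP[z zE yz]; apply/eqP; rewrite eq_sym; apply/negPn/negP => qy.
  have qz : q != z by apply: contra_neq qy => qz; rewrite yz -qz tq.
  case/negP: cE; apply/allpairsP; exists (phi' y, phi' z); split=> /=; try exact: map_f.
  have := tphi (phi' z); rewrite (isoVK ff' qz) -yz tauE => ->.
  by rewrite (isoK ff') // addrAC subrr add0r.
have qE : q \in E by rewrite -rx map_f.
exists [:: act r a; act t (act r a)] => g gu ga.
have e1 : act g (act 1 (act r a)) = act 1 (act r a) by rewrite act1 ga // mem_head.
have e2 : act g (act t (act r a)) = act t (act r a) by rewrite ga // !inE eqxx orbT.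
have id1 : map (fn 1) E = E by rewrite map_id_in // => y _; apply: fn1.
have [|y yE gy] := onE 1 g munit1 gu e1 q; first by rewrite id1.
have [|z zE gz] := onE t g tu gu e2 q; first by rewrite -[X in X \in _]tq map_f.
have yz : y = z by apply: (@fn_injective g); rewrite gy gz.
have yq : y = q by apply: meet; [rewrite id1 in yE|rewrite yz].
by rewrite -{1}yq.
Qed.

(** Units [g] and [g'] approximate [f] and [f'] at [q] and on [s]; then [g^-1 * g'] fixes [s]
    pointwise, hence fixes [q]. *)
Lemma act_open f q : exists s : seq Omega, forall f',
  {in s, act f' =1 act f} -> fn f' q = fn f q.
Proof.
have [s sP] := point_stabiliser q; exists s => f' ff'.
have /choice[F FP] := act_continuous f.
have /choice[F' F'P] := act_continuous f'.
have [g gu gE] := unit_approx f (q :: flatten [seq F a | a <- s]).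
have [g' g'u g'E] := unit_approx f' (q :: flatten [seq F' a | a <- s]).
have [h gh hg] := gu.
rewrite -gE ?mem_head // -g'E ?mem_head //.
rewrite -[in RHS](sP (h * g')) ?fnM ?(fnK gh) //.
  by apply: munitM => //; apply: munit_sym gh hg.
have in_flat (B : Omega -> seq rat) a x : a \in s -> x \in B a ->
    x \in q :: flatten [seq B a | a <- s].
  by move=> aS xB; rewrite inE; apply/orP; right; apply/flattenP; exists (B a); rewrite ?map_f.
move=> a aS; rewrite actM.
have -> : act g' a = act g a.
  rewrite (F'P a g') ?(FP a g) ?ff' // => x xF.
    by rewrite gE //; apply: in_flat xF.
  by rewrite g'E //; apply: in_flat xF.
by rewrite -actM hg act1.
Qed.

End Action.

(** * Topology of submonoids and conclusion *)

Lemma nbhs_submonoid (X : countType) (N : submonoid (Tr X)) (f : N) (A : set N) :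
  nbhs f A <-> exists s : seq X,
    forall g : N, {in s, (val g : X -> X) =1 (val f : X -> X)} -> A g.
Proof.
split=> [[_ [[B Bop <-] Bf sBA]]|[s sA]].
  have /nbhs_Tr[s sB] : nbhs (val f : Tr X) B by apply: open_nbhs_nbhs; split.
  by exists s => g gs; apply/sBA/sB.
have fs : nbhs (val f : Tr X) [set g : Tr X | {in s, g =1 val f}]%classic.
  by apply/nbhs_Tr; exists s.
have : nbhs f (fun g : N => {in s, (val g : X -> X) =1 (val f : X -> X)}).
  exact: (@initial_continuous N (Tr X) val f _ fs).
by apply: filterS => g; apply: sA.
Qed.

(** [theta] is read as an action on [Omega]. Its continuity is [act_continuous] and that of its
    inverse is [act_open], collected over finite sets of points. *)
Theorem theorem3p7 : automatic_homeomorphicity Emb_circ.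
Proof.
move=> Omega N theta clN [[theta1 thetaM] [eta thetaK etaK]].
pose act f : Omega -> Omega := val (theta f).
have act1 a : act 1 a = a by rewrite /act theta1.
have actM f g a : act (f * g) a = act f (act g a) by rewrite /act thetaM.
have act_faithful f g : act f =1 act g -> f = g.
  by move=> /funext fg; apply: (can_inj thetaK); apply: val_inj.
have act_closed (T : Omega -> Omega) :
    (forall s : seq Omega, exists f, {in s, act f =1 T}) -> exists f, act f =1 T.
  (* Every basic neighbourhood of [T] meets [N], so the closed set [N] contains [T]. *)
  move=> TN; have NT : submonoid_set N (T : Tr Omega).
    apply: clN => B /nbhs_Tr[s sB]; have [f fT] := TN s.
    exists (val (theta f)); split; last exact: sB.
    by have := valP (theta f); rewrite inE.
  have NT' : (T : Tr Omega) \in submonoid_set N by rewrite inE.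
  by exists (eta (exist _ (T : Tr Omega) NT')) => a; rewrite /act etaK.
split.
  move=> f A /nbhs_submonoid[s sA]; apply/nbhs_submonoid.
  have /choice[F FP] := act_continuous act1 actM act_faithful act_closed f.
  exists (flatten [seq F a | a <- s]) => g gf; apply: sA => a aS.
  apply: FP => x xF; apply: gf; apply/flattenP; exists (F a) => //.
  exact: map_f.
exists eta; split=> // h A /nbhs_submonoid[s sA]; apply/nbhs_submonoid.
have /choice[S SP] := act_open act1 actM act_faithful act_closed (eta h).
exists (flatten [seq S q | q <- s]) => k kh; apply: sA => q qs.
apply: SP => a aS; rewrite /act !etaK; apply: kh; apply/flattenP.
by exists (S q) => //; apply: map_f.
Qed.
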